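(* Let $m,n$ be positive integers with $n/2\le m\le n-1$. Let $a_m,\dots,a_n$ be algebraically independent variables over $k$, $F=k(a_m,\dots,a_n)$, and $E=F[x]/(f(x))$, where \[ f(x)=x^n+a_m x^{n-m}+\dots+a_{n-1}x+a_n . \] Then $\tau(E/F)=n-m$. Equivalently, every polynomial obtained from $f(x)$ by a Tschirnhaus transformation has at least $n-m$ coefficients that are algebraically independent over $k$, and $n-m$ is attained.
   Context: $k$ is a field of characteristic $0$ (not necessarily algebraically closed). For a field extension $E/F$ of degree $n$ with $k\subset F$, and a generator $z$ of $E$ over $F$ (i.e. $E=F(z)$) with minimal polynomial $t^n+\alpha_1(z)t^{n-1}+\dots+\alpha_n(z)$ over $F$, $\tau(E/F)$ is the minimum of $\operatorname{trdeg}_k k(\alpha_1(z),\dots,\alpha_n(z))$ over all such generators $z$. A Tschirnhaus transformation of an irreducible monic polynomial $\alpha\in F[x]$ of degree $n$ is an isomorphism $F[x]/(\alpha(x))\cong F[t]/(\beta(t))$ with $\beta$ monic irreducible of degree $n$; $\beta$ is the minimal polynomial of a generator of $F[x]/(\alpha(x))$ over $F$. *)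

(* Defs.v *)
From HB Require Import structures.
From mathcomp Require Import all_boot all_order all_algebra.
From mathcomp Require Import fraction qpoly.
From mathcomp Require Import boolp.
From mathcomp Require Import mpoly.
Set Implicit Arguments. Unset Strict Implicit. Unset Printing Implicit Defensive.
Import GRing.Theory.
Local Open Scope ring_scope.

Section Trdeg.
Variables (k L : fieldType) (emb : k -> L).

Definition alg_indep (s : seq L) : Prop :=
  forall p : {mpoly k[size s]},
    (map_mpoly emb p).@[fun i : 'I_(size s) => s`_i] = 0 -> p = 0.

Definition trdeg (s : seq L) : nat :=
  \max_(b : (size s).-tuple bool | `[< alg_indep (mask b s) >]) size (mask b s).
End Trdeg.

Section Gen.
Variables (F : fieldType) (E : algType F).

Definition generates (z : E) : Prop :=
  forall e : E, exists q : {poly F}, e = horner_alg z q.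

Definition is_minpoly (z : E) (p : {poly F}) : Prop :=
  [/\ p \is monic, horner_alg z p = 0 &
      forall q : {poly F}, horner_alg z q = 0 -> (p %| q)%R].

Definition lower_coefs (p : {poly F}) : seq F :=
  [seq p`_i | i <- iota 0 (size p).-1].
End Gen.

Definition tau_is (k F : fieldType) (emb : k -> F) (E : algType F)
  (d : nat) : Prop :=
  (exists (z : E) (p : {poly F}),
      [/\ generates z, is_minpoly z p & trdeg emb (lower_coefs p) = d])
  /\ (forall (z : E) (p : {poly F}), generates z -> is_minpoly z p ->
        (d <= trdeg emb (lower_coefs p))%N).

(* With N = n - m + 1, variable a_(m+i) is 'X_i, i < N. *)
Definition ratfun (k : fieldType) (N : nat) := {fraction {mpoly k[N]}}.

Definition const_ratfun (k : fieldType) (N : nat) (c : k) : ratfun k N :=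
  @FracField.tofrac _ (mpolyC N c).

Definition gen_var (k : fieldType) (N : nat) (i : 'I_N) : ratfun k N :=
  @FracField.tofrac _ ('X_i : {mpoly k[N]}).

Definition f_poly (k : fieldType) (m n : nat) : {poly ratfun k (n - m).+1} :=
  'X^n + \sum_(i < (n - m).+1) (gen_var k i)%:P * 'X^(n - m - i).

(* Main.v *)
(** Lower bound.  In a field [K] containing [k], let [c_1, ..., c_m] be distinct
    elements such that [Q = (x - c_1)^2 ... (x - c_r)^2 (x - c_(r+1)) ... (x - c_m)],
    with [r = n - m], has the shape [x^n + (terms of degree <= r)].  A small
    generic perturbation of [Q] of degree at most [r] realizes [f] over the power
    series ring [K[[s_0, ..., s_r]]]: it splits every double root [c_i] into two
    roots [x_i] and [sigma_i x_i], exchanged by the reflection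
    [sigma_i : s_i -> - s_i], while all reflections fix the coefficients of [f].
    If [z] is a generator and [z_i] its value at [x_i], then
    [delta_i = z_i - sigma_i z_i] is nonzero, odd under [sigma_i] and even under
    the other reflections, so the leading exponents of the [delta_i] are linearly
    independent modulo 2.  Hence the [delta_i] are algebraically independent; as
    differences of roots of the minimal polynomial of [z] they are algebraic over
    its coefficients, which therefore have transcendence degree at least [r].

    The [c_i] exist because [m - 1] forms in [m] variables have a common nonzero
    zero over some extension field, and a multiplicity count shows that the
    coordinates of such a zero are distinct.

    Upper bound: with [c = a_n / a_(n-1)], the two lowest coefficients of the
    minimal polynomial of [x / c] coincide. *)

Require Import Defs.
From HB Require Import structures.
From mathcomp Require Import all_boot all_order all_algebra.
From mathcomp Require Import fraction qpoly ring_quotient generic_quotient.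
From mathcomp Require Import boolp.
From mathcomp Require classical_sets.
From mathcomp Require Import mpoly.
From mathcomp Require Import ring zify.
Set Implicit Arguments. Unset Strict Implicit. Unset Printing Implicit Defensive.
Import Order.TTheory GRing.Theory.
Local Open Scope ring_scope.

(** * Algebraic dependence by counting *)

Lemma rmorph_mmap (A B D : comNzRingType) n (h : {rmorphism B -> D})
    (f : A -> B) (g : 'I_n -> B) p :
  h (mmap f g p) = mmap (h \o f) (h \o g) p.
Proof.
rewrite /mmap rmorph_sum /=; apply: eq_bigr => mu _.
rewrite rmorphM /=; congr (_ * _).
by rewrite rmorph_prod; apply: eq_bigr => i _; rewrite rmorphXn.
Qed.

Lemma eq_mmap (A B : nzRingType) n (f f' : A -> B) (g g' : 'I_n -> B) p :
  f =1 f' -> g =1 g' -> mmap f g p = mmap f' g' p.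
Proof.
move=> ff gg; apply: eq_bigr => mu _; rewrite ff; congr (_ * _).
by apply: eq_bigr => i _; rewrite gg.
Qed.

Lemma mmap1D (R : comNzRingType) n (h : 'I_n -> R) m1 m2 :
  mmap1 h (m1 + m2) = mmap1 h m1 * mmap1 h m2.
Proof.
by rewrite /mmap1 -big_split /=; apply: eq_bigr => i _; rewrite mnmDE exprD.
Qed.

Section AlgebraicBound.
Variables (k L : fieldType) (emb : {rmorphism k -> L}).

Definition indep n (y : 'I_n -> L) : Prop :=
  forall p : {mpoly k[n]}, mmap emb y p = 0 -> p = 0.

(** The coefficients are polynomials in the [b j] rather than elements of the field they generate,
    so that their degrees can be bounded. The leading coefficient must survive at [b] for the
    equation to be nontrivial. *)
Definition algebraic_on d (b : 'I_d -> L) (x : L) : Prop :=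
  exists2 P : {poly {mpoly k[d]}},
    mmap emb b (lead_coef P) != 0 & root (map_poly (mmap emb b) P) x.

Section Span.
Variables (r d M D : nat) (y : 'I_r -> L) (b : 'I_d -> L).

(** For fixed [M] and [D] the size of this index set grows like [N ^ d], which the counting argument
    exploits. *)
Definition box N : finType :=
  ({ffun 'I_d -> 'I_(D * N).+1} * {ffun 'I_r -> 'I_M})%type.

Definition boxmon N (q : box N) : L :=
  (\prod_j b j ^+ q.1 j) * (\prod_i y i ^+ q.2 i).

Definition in_span N (x : L) : Prop :=
  exists c : box N -> k, x = \sum_q emb (c q) * boxmon q.

Lemma in_span0 N : in_span N 0.
Proof.
by exists (fun=> 0); rewrite big1 // => q _; rewrite rmorph0 mul0r.
Qed.

Lemma in_spanD N x1 x2 : in_span N x1 -> in_span N x2 -> in_span N (x1 + x2).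
Proof.
move=> [c1 ->] [c2 ->]; exists (fun q => c1 q + c2 q).
by rewrite -big_split /=; apply: eq_bigr => q _; rewrite rmorphD mulrDl.
Qed.

Lemma in_spanZ N a x : in_span N x -> in_span N (emb a * x).
Proof.
move=> [c ->]; exists (fun q => a * c q).
by rewrite mulr_sumr; apply: eq_bigr => q _; rewrite rmorphM mulrA.
Qed.

Lemma in_span_sum N (I : Type) (s : seq I) (P : pred I) (F : I -> L) :
  (forall i, P i -> in_span N (F i)) -> in_span N (\sum_(i <- s | P i) F i).
Proof.
move=> h; apply: (big_ind (in_span N)) => //; first exact: in_span0.
exact: in_spanD.
Qed.

Lemma in_span_mon N (al : 'X_{1..d}) (mu : 'X_{1..r}) :
  (forall j, al j <= D * N)%N -> (forall i, mu i < M)%N ->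
  in_span N (mmap1 b al * mmap1 y mu).
Proof.
move=> hal hmu.
pose q0 : box N := ([ffun j => inord (al j)], [ffun i => Ordinal (hmu i)]).
exists (fun q => (q == q0)%:R); rewrite (bigD1 q0) //= eqxx rmorph1 mul1r big1.
  rewrite addr0 /boxmon /mmap1 /=; congr (_ * _); apply: eq_bigr => i _.
    by rewrite ffunE inordK // ltnS.
  by rewrite ffunE.
by move=> q /negbTE->; rewrite rmorph0 mul0r.
Qed.

Variables (g : {mpoly k[d]}) (a : 'I_r -> nat -> {mpoly k[d]}).
Hypothesis gD : forall m, m \in msupp g -> forall j, (m j <= D)%N.
Hypothesis aD : forall i l m, m \in msupp (a i l) -> forall j, (m j <= D)%N.
Hypothesis yE : forall i, mmap emb b g * y i ^+ M =
  \sum_(l < M) mmap emb b (a i l) * y i ^+ l.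

Lemma in_span_mulb N (p : {mpoly k[d]}) (al : 'X_{1..d}) (mu : 'X_{1..r}) :
  (forall m, m \in msupp p -> forall j, (m j <= D)%N) ->
  (forall j, al j <= D * N)%N -> (forall i, mu i < M)%N ->
  in_span N.+1 (mmap emb b p * (mmap1 b al * mmap1 y mu)).
Proof.
move=> hp hal hmu; rewrite /mmap mulr_suml big_seq_cond.
apply: in_span_sum => m; rewrite andbT => hm.
rewrite -mulrA; apply: in_spanZ; rewrite mulrA -mmap1D.
apply: in_span_mon => // j; rewrite mnmDE mulnS leq_add //; exact: hp.
Qed.

Lemma in_span_lin N (f : L -> L) : {morph f : u v / u + v} -> f 0 = 0 ->
  (forall c u, f (emb c * u) = emb c * f u) ->
  (forall (al : 'X_{1..d}) (mu : 'X_{1..r}),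
    (forall j, al j <= D * N)%N -> (forall i, mu i < M)%N ->
    in_span N.+1 (f (mmap1 b al * mmap1 y mu))) ->
  forall x, in_span N x -> in_span N.+1 (f x).
Proof.
move=> fD f0 fZ fm x [c ->]; rewrite (big_morph f fD f0).
apply: in_span_sum => q _; rewrite fZ; apply: in_spanZ.
have -> : boxmon q = mmap1 b [multinom (q.1 j : nat) | j < d]
                   * mmap1 y [multinom (q.2 i : nat) | i < r].
  by congr (_ * _); apply: eq_bigr => i _; rewrite mnmE.
by apply: fm => i; rewrite mnmE // -ltnS.
Qed.

Lemma in_span_g N x : in_span N x -> in_span N.+1 (mmap emb b g * x).
Proof.
apply: (@in_span_lin N (fun x => mmap emb b g * x)).
- by move=> u v; rewrite mulrDr.
- by rewrite mulr0.
- by move=> c u; rewrite mulrCA.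
by move=> al mu hal hmu; apply: in_span_mulb.
Qed.

(** Either the exponent of [y i] rises and stays below [M], or it reaches [M] and [yE] trades
    [g * y i ^+ M] for lower powers. In both cases the exponents of [b] grow by at most [D]. *)
Lemma in_span_gy N i x : in_span N x -> in_span N.+1 (mmap emb b g * y i * x).
Proof.
apply: (@in_span_lin N (fun x => mmap emb b g * y i * x)).
- by move=> u v; rewrite mulrDr.
- by rewrite mulr0.
- by move=> c u; rewrite mulrCA.
move=> al mu hal hmu.
have split_mu e : mmap1 y [multinom if j == i then e else mu j | j < r]
    = y i ^+ e * \prod_(j | j != i) y j ^+ mu j.
  rewrite /mmap1 (bigD1 i) //= mnmE eqxx; congr (_ * _).
  by apply: eq_bigr => j /negbTE ji; rewrite mnmE ji.
have mu_i : mmap1 y mu = y i ^+ mu i * \prod_(j | j != i) y j ^+ mu j.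
  by rewrite /mmap1 (bigD1 i).
have [lt|ge] := ltnP (mu i).+1 M.
  have -> : mmap emb b g * y i * (mmap1 b al * mmap1 y mu) =
     mmap emb b g * (mmap1 b al *
       mmap1 y [multinom if j == i then (mu i).+1 else mu j | j < r]).
    by rewrite split_mu mu_i exprS; ring.
  by apply: in_span_mulb => // j; rewrite mnmE; case: eqP.
have {ge} eM : M = (mu i).+1 by apply/eqP; rewrite eqn_leq ge hmu.
have -> : mmap emb b g * y i * (mmap1 b al * mmap1 y mu) =
   \sum_(l < M) mmap emb b (a i l) * (mmap1 b al *
     mmap1 y [multinom if j == i then l : nat else mu j | j < r]).
  transitivity ((mmap emb b g * y i ^+ M) *
      (mmap1 b al * \prod_(j | j != i) y j ^+ mu j)).
    by rewrite mu_i [in RHS]eM exprS; ring.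
  rewrite yE mulr_suml; apply: eq_bigr => l _.
  by rewrite split_mu; ring.
apply: in_span_sum => l _; apply: in_span_mulb => //.
  by move=> m; exact: aD.
by move=> j; rewrite mnmE; case: eqP.
Qed.

(** Each factor [y i] of the monomial consumes one factor of [g ^+ N]; surplus factors are absorbed
    by [in_span_g]. *)
Lemma in_span_monomial (mu : 'X_{1..r}) N : (0 < M)%N -> (mdeg mu <= N)%N ->
  in_span N (mmap emb b g ^+ N * mmap1 y mu).
Proof.
move=> M0; elim: N mu => [|N IH] mu.
  rewrite leqn0 mdeg_eq0 => /eqP ->; rewrite expr0 mul1r.
  have -> : mmap1 y 0%MM = mmap1 b 0%MM * mmap1 y 0%MM by rewrite !mmap11 mul1r.
  by apply: in_span_mon => i; rewrite mnm0E.
rewrite leq_eqVlt => /orP [/eqP dN|]; last first.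
  by rewrite ltnS => /IH /in_span_g; rewrite mulrA -exprS.
have [i hi] : exists i, mu i != 0%N.
  apply/existsP; rewrite -negb_forall; apply/negP => /forallP h.
  have m0 : mu = 0%MM by apply/mnmP => i; rewrite mnm0E; apply/eqP/h.
  by move: dN; rewrite m0 mdeg0.
have hU : (U_(i) <= mu)%MM by rewrite lep1mP.
have e : mu = (U_(i) + (mu - U_(i)))%MM by rewrite addmC submK.
have dm : (mdeg (mu - U_(i)) <= N)%N.
  by rewrite -ltnS -dN {2}e mdegD mdeg1.
have := in_span_gy i (IH _ dm).
by rewrite {2}e mmap1D mmap1U exprS; congr in_span; ring.
Qed.

End Span.


Lemma many_vectors_dependent (m n : nat) (A : 'M[k]_(m, n)) : (n < m)%N ->
  exists2 u : 'rV[k]_m, u != 0 & u *m A = 0.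
Proof.
move=> lt; have /rowV0Pn [u] : kermx A != 0.
  rewrite kermx_eq0 /row_free; apply/negP => /eqP e.
  by have := rank_leq_col A; rewrite e leqNgt lt.
by move=> /sub_kermxP uA u0; exists u.
Qed.

Lemma algebraic_onP r d (y : 'I_r -> L) (b : 'I_d -> L) :
  (forall i, algebraic_on b (y i)) ->
  exists M (g : {mpoly k[d]}) (a : 'I_r -> nat -> {mpoly k[d]}),
    [/\ (0 < M)%N, mmap emb b g != 0 & forall i, mmap emb b g * y i ^+ M =
      \sum_(l < M) mmap emb b (a i l) * y i ^+ l].
Proof.
move=> /fin_all_exists2 [P lP rP].
pose M := (\sum_i size (P i)).+1.
have PM i : ((size (P i)).-1 <= M)%N.
  by rewrite /M (bigD1 i) //=; lia.
pose g := \prod_i lead_coef (P i).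
(* Shifting by a power of ['X] and multiplying by the other leading coefficients brings all
   equations to the same degree [M] and the same leading coefficient [g]. *)
pose Q i := P i * 'X^(M - (size (P i)).-1) * (\prod_(j | j != i) lead_coef (P j))%:P.
have gQ i : g = (Q i)`_M.
  rewrite coefMC coefMXn ltnNge leq_subr /= subKn // -lead_coefE.
  by rewrite /g (bigD1 i).
have P0 i : P i != 0.
  by apply/eqP => e; move: (lP i); rewrite e lead_coef0 rmorph0 eqxx.
have sQ i : (size (Q i) <= M.+1)%N.
  rewrite /Q mulrC mul_polyC; apply: (leq_trans (size_scale_leq _ _)).
  rewrite size_mulXn // -ltnS.
  by have := PM i; have := P0 i; rewrite -size_poly_gt0; lia.
exists M, g, (fun i l => - (Q i)`_l); split=> //.
  rewrite /g rmorph_prod /=; apply/prodf_neq0 => i _; exact: lP.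
move=> i; have : root (map_poly (mmap emb b) (Q i)) (y i).
  rewrite /Q !rmorphM /= !rootM; move: (rP i); rewrite rootE => /eqP h.
  by rewrite /root h eqxx.
rewrite /root (horner_coef_wide _ (leq_trans (size_poly _ _) (sQ i))).
rewrite big_ord_recr /= coef_map /= -gQ addrC addr_eq0 => /eqP ->.
rewrite -sumrN; apply: eq_bigr => l _.
by rewrite coef_map /= rmorphN mulNr.
Qed.

(* A counting argument: for large [l] the [l ^ r] monomials in [y] with
   exponents below [l], all multiplied by the same power of the leading
   coefficient, lie in a space of dimension [O(l ^ d)]. *)
Lemma indep_algebraic_on_leq r d (y : 'I_r -> L) (b : 'I_d -> L) :
  indep y -> (forall i, algebraic_on b (y i)) -> (r <= d)%N.
Proof.
move=> iy /algebraic_onP [M [g [a [M0 g0 yE]]]].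
rewrite leqNgt; apply/negP => ltdr.
pose supps := msupp g ++ flatten [seq msupp (a il.1 il.2) | il : 'I_r * 'I_M].
(* Only the coefficients with [l < M] are controlled; the value 0 elsewhere makes the degree bound
   hold for every [l]. *)
pose a' i l := if (l < M)%N then a i l else 0.
pose D := (\sum_(m <- supps) mdeg m)%N.
have suppsD (m : 'X_{1..d}) : m \in supps -> forall j, (m j <= D)%N.
  move=> hm j; apply: (@leq_trans (mdeg m)).
    by rewrite mdegE (bigD1 j) //= leq_addr.
  by rewrite /D (big_rem m) //= leq_addr.
have gD (m : 'X_{1..d}) : m \in msupp g -> forall j, (m j <= D)%N.
  by move=> hm; apply: suppsD; rewrite mem_cat hm.
have aD i l (m : 'X_{1..d}) : m \in msupp (a' i l) -> forall j, (m j <= D)%N.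
  rewrite /a'; case: ltnP => [lM hm|_]; last by rewrite msupp0.
  apply: suppsD; rewrite mem_cat; apply/orP; right.
  by apply/flatten_mapP; exists (i, Ordinal lM); rewrite ?mem_enum.
have yE' i : mmap emb b g * y i ^+ M =
    \sum_(l < M) mmap emb b (a' i l) * y i ^+ l.
  by rewrite yE; apply: eq_bigr => l _; rewrite /a' ltn_ord.
(* This makes [(D * r).+1 ^ d * M ^ r < l], so the box for [N = r * l] has at most [(D * r).+1 ^ d *
   l ^ d * M ^ r < l ^ d.+1 <= l ^ r] elements. *)
pose l := ((D * r).+1 ^ d * M ^ r).+1.
pose N := (r * l)%N.
pose T : finType := {ffun 'I_r -> 'I_l}.
pose mon (nu : T) : 'X_{1..r} := [multinom (nu i : nat) | i < r].
have mon_inj : injective mon.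
  move=> u v /mnmP h; apply/ffunP => i; apply: val_inj.
  by have := h i; rewrite !mnmE.
have hspan (nu : T) : in_span M D y b N (mmap emb b g ^+ N * mmap1 y (mon nu)).
  apply: in_span_monomial gD aD yE' _ _ M0 _.
  rewrite mdegE /N -[X in (_ <= X * _)%N]card_ord -sum_nat_const.
  by apply: leq_sum => i _; rewrite mnmE ltnW.
have [c hc] := fin_all_exists hspan.
pose A : 'M[k]_(#|T|, #|box r d M D N|) :=
  \matrix_(i, j) c (enum_val i) (enum_val j).
have [|u u0 uA] := many_vectors_dependent A.
  rewrite /box card_prod !card_ffun !card_ord.
  have h1 : ((D * N).+1 <= (D * r).+1 * l)%N.
    by rewrite /N mulnA [leqRHS]mulSn -addn1 addnC leq_add2r.
  apply: (@leq_ltn_trans (((D * r).+1 * l) ^ d * M ^ r)).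
    rewrite leq_mul2r; apply/orP; right.
    by case: (d) => [|e] //; rewrite leq_exp2r.
  rewrite expnMn -mulnA [(l ^ d * _)%N]mulnC mulnA.
  apply: (@leq_trans (l ^ d.+1)).
    by rewrite expnS ltn_pmul2r ?expn_gt0.
  by rewrite leq_pexp2l.
(* A linear relation between the multiplied monomials is a polynomial relation among the [y i], up
   to the nonzero factor [g ^+ N]. *)
pose p : {mpoly k[r]} := \sum_i u 0 i *: 'X_[mon (enum_val i)].
have : p = 0.
  apply: iy; apply: (mulfI (expf_neq0 N g0)); rewrite mulr0 /p raddf_sum /=.
  rewrite mulr_sumr.
  transitivity (\sum_q emb (\sum_i u 0 i * c (enum_val i) q) * boxmon y b q).
    transitivity (\sum_i \sum_q emb (u 0 i * c (enum_val i) q) * boxmon y b q).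
      apply: eq_bigr => i _; rewrite mmapZ mmapX mulrCA hc mulr_sumr.
      by apply: eq_bigr => q _; rewrite rmorphM mulrA.
    rewrite exchange_big; apply: eq_bigr => q _.
    by rewrite rmorph_sum mulr_suml.
  apply: big1 => q _; have /rowP /(_ (enum_rank q)) := uA.
  rewrite !mxE => h; rewrite (_ : \sum_i _ = 0) ?rmorph0 ?mul0r //.
  by rewrite -[RHS]h; apply: eq_bigr => i _; rewrite mxE enum_rankK.
move=> p0; move/eqP: u0; apply; apply/rowP => i; rewrite mxE.
have := congr1 (mcoeff (mon (enum_val i))) p0.
rewrite mcoeff0 raddf_sum (bigD1 i) //= big1 => [|j ji].
  by rewrite addr0 mcoeffZ mcoeffX eqxx mulr1.
rewrite mcoeffZ mcoeffX; case: eqP => [/mon_inj/enum_val_inj e|_].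
  by rewrite e eqxx in ji.
by rewrite mulr0.
Qed.

End AlgebraicBound.

(** * Ideals avoiding a power *)

Section DomainUnits.
Variable R : comNzRingType.

Definition has_inv (x : R) : bool := `[< exists y, y * x = 1 >].

(** Outside the units the value is the argument itself, as the interface of rings with inverses
    demands. *)
Definition some_inv (x : R) : R :=
  if pselect (exists y, y * x = 1) is left h then projT1 (cid h) else x.

Lemma some_invP : {in has_inv, left_inverse 1 some_inv *%R}.
Proof.
move=> x /asboolP h; rewrite /some_inv; case: pselect => // h'.
exact: (projT2 (cid h')).
Qed.

Lemma has_inv_intro (x y : R) : y * x = 1 -> has_inv x.
Proof. by move=> h; apply/asboolP; exists y. Qed.

Lemma some_inv_out : {in [predC has_inv], some_inv =1 id}.
Proof. by move=> x /asboolPn h; rewrite /some_inv; case: pselect. Qed.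

Hypothesis domR : forall x y : R, x * y = 0 -> (x == 0) || (y == 0).

Lemma fraction_field_of_domain : exists (K : fieldType) (phi : {rmorphism R -> K}),
  injective phi.
Proof.
pose U : comUnitRingType := HB.pack (GRing.ComNzRing.sort R)
  (GRing.ComNzRing_hasMulInverse.Build R some_invP has_inv_intro some_inv_out).
pose D : idomainType := HB.pack (GRing.ComUnitRing.sort U)
  (GRing.ComUnitRing_isIntegral.Build U domR).
exists {fraction D}, (@FracField.tofrac D : {rmorphism D -> {fraction D}}).
by move=> u v /eqP; rewrite tofrac_eq => /eqP.
Qed.

End DomainUnits.

Section PrimeAvoiding.
Variables (R : comNzRingType) (J : R -> Prop) (x : R).
Hypothesis J0 : J 0.
Hypothesis JD : forall u v, J u -> J v -> J (u + v).
Hypothesis JM : forall a u, J u -> J (a * u).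
Hypothesis xJ : forall n, ~ J (x ^+ n).

Definition avoiding_ideal (A : R -> Prop) : Prop :=
  [/\ forall u, J u -> A u, forall u v, A u -> A v -> A (u + v),
      forall a u, A u -> A (a * u) & forall n, ~ A (x ^+ n)].

(** An ideal maximal among those containing [J] and no power of [x] is prime: adjoining an outside
    element [u] or [v] captures a power of [x], and multiplying the two expressions would put a
    power of [x] in the ideal if [u * v] were there. *)
Lemma prime_avoiding : exists q : pred R,
  [/\ idealr_closed q, prime_idealr_closed q, forall u, J u -> u \in q &
      x \notin q].
Proof.
pose P (A : classical_sets.set R) := A = classical_sets.set0 \/ avoiding_ideal A.
have [|A [PA Amax]] := @classical_sets.Zorn_bigcup R P.
  move=> F FP Ftot.
  have [[A0 [FA0 gA0]]|none] := pselect (exists A, F A /\ avoiding_ideal A).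
    right; have [JA _ _ _] := gA0.
    have good B u : F B -> B u -> avoiding_ideal B.
      by move=> FB Bu; case: (FP _ FB) => // e; move: Bu; rewrite e.
    split.
    - by move=> u Ju; exists A0 => //; exact: JA.
    - move=> u v [B FB Bu] [C FC Cv].
      have [_ BD _ _] := good _ _ FB Bu; have [_ CD _ _] := good _ _ FC Cv.
      case: (Ftot _ _ FB FC) => sub; [exists C | exists B] => //.
        by apply: CD => //; exact: sub.
      by apply: BD => //; exact: sub.
    - move=> a u [B FB Bu]; have [_ _ BM _] := good _ _ FB Bu.
      by exists B => //; exact: BM.
    - move=> n [B FB Bu]; have [_ _ _ Bx] := good _ _ FB Bu; exact: (Bx n).
  left; apply/funext => u; apply/propext; split=> // -[B FB Bu].
  case: (FP _ FB) => [e|gB]; first by move: Bu; rewrite e.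
  by case: none; exists B.
have gJ : avoiding_ideal J by split.
have gA : avoiding_ideal A.
  case: PA => // e; case: (Amax J); last by right.
  by split; rewrite e // => /(_ 0 J0).
have [JA AD AM Ax] := gA.
have A0 : A 0 by apply: JA.
have enlarge u : ~ A u -> exists n a v, A v /\ x ^+ n = a * u + v.
  move=> nAu; pose B (w : R) := exists a v, A v /\ w = a * u + v.
  apply: contrapT => no; apply: (Amax B).
    split; first by move=> w Aw; exists 0, w; rewrite mul0r add0r.
    by move=> /(_ u) h; apply: nAu; apply: h; exists 1, 0; rewrite mul1r addr0.
  right; split.
  - by move=> w Jw; exists 0, w; rewrite mul0r add0r; split=> //; exact: JA.
  - move=> _ _ [a [v [Av ->]]] [a' [v' [Av' ->]]].
    exists (a + a'), (v + v'); split; first exact: AD.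
    by rewrite mulrDl addrACA.
  - move=> c _ [a [v [Av ->]]]; exists (c * a), (c * v).
    by split; [exact: AM | rewrite mulrDr mulrA].
  - by move=> n [a [v [Av e]]]; apply: no; exists n, a, v.
exists (fun u => `[< A u >]); split.
- split; first exact/asboolP.
    by apply/negP => /asboolP; rewrite -(expr0 x); exact: Ax.
  move=> a u v /asboolP Au /asboolP Av; apply/asboolP.
  by apply: AD => //; exact: AM.
- move=> u v /asboolP Auv; rewrite -[_ || _]negbK negb_or; apply/negP.
  move=> /andP [/asboolPn /enlarge [n [a [w [Aw e]]]]].
  move=> /asboolPn /enlarge [n' [a' [w' [Aw' e']]]].
  apply: (Ax (n + n')%N); rewrite exprD e e'.
  have -> : (a * u + w) * (a' * v + w') =
    (a * a') * (u * v) + ((a * u) * w' + (a' * v + w') * w) by ring.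
  by apply: (AD); [apply: (AM) | apply: (AD); apply: (AM)].
- by move=> u Ju; apply/asboolP/JA.
- by apply/asboolPn => Axx; apply: (Ax 1%N); rewrite expr1.
Qed.

(** The quotient by a prime avoiding [x] is a domain, and its fraction field is the target. This is
    a Nullstellensatz with values in some extension field. *)
Lemma rmorphism_to_field : exists (K : fieldType) (phi : {rmorphism R -> K}),
  (forall u, J u -> phi u = 0) /\ phi x != 0.
Proof.
have [q [qI qp qJ qx]] := prime_avoiding.
pose I : prime_idealr R := HB.pack q (isIdealr.Build R q qI)
  (isPrimeIdealrClosed.Build R q qp).
have [K [phi phi_inj]] := fraction_field_of_domain
  (@Quotient.rquot_IdomainAxiom R I).
pose piQ : {rmorphism R -> {ideal_quot I}} := \pi_(Quotient.quot I)%qT.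
exists K, (phi \o piQ : {rmorphism R -> K}).
have pi0 u : (piQ u == 0) = (u \in q).
  by rewrite -[RHS]/(u \in I) -[u in RHS]subr0 Quotient.idealrBE -(rmorph0 piQ).
split=> [u Ju|] /=.
  have /eqP -> : piQ u == 0 by rewrite pi0 qJ.
  by rewrite rmorph0.
by rewrite -(rmorph0 phi) (inj_eq phi_inj) pi0.
Qed.

End PrimeAvoiding.

(** * Common zeros of forms *)

Section CommonZero.
Variables (k : fieldType) (m d : nat).
Variables (g : 'I_d -> {mpoly k[m]}) (e : 'I_d -> nat).
Hypothesis gH : forall j, g j \is (e j).-homog.
Hypothesis e_gt0 : forall j, (0 < e j)%N.

Definition in_ideal (p : {mpoly k[m]}) : Prop :=
  exists h : 'I_d -> {mpoly k[m]}, p = \sum_j h j * g j.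

(** As the [g j] are homogeneous, only the part of degree [D - e j] of each cofactor contributes in
    degree [D]. *)
Lemma in_ideal_homog D p : p \is D.-homog -> in_ideal p ->
  exists2 h : 'I_d -> {mpoly k[m]}, p = \sum_j h j * g j &
    forall j mu, mu \in msupp (h j) -> (mdeg mu + e j = D)%N.
Proof.
move=> pD [h pE].
pose h' j := \sum_(mu <- msupp (h j) | (mdeg mu + e j == D)%N)
  (h j)@_mu *: 'X_[mu].
exists h'.
  rewrite -(pihomog_dE pD) {1}pE raddf_sum /=; apply: eq_bigr => j _.
  rewrite {1}[h j]mpolyE !mulr_suml raddf_sum /= [RHS]big_mkcond /=.
  apply: eq_bigr => mu _; rewrite -scalerAl linearZ /=.
  have hXg : 'X_[mu] * g j \is (mdeg mu + e j).-homog.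
    by apply: dhomogM (gH j); rewrite dhomogX.
  case: ifPn => [/eqP eD|nD].
    by rewrite pihomog_dE -?eD // scalerAl.
  by rewrite (pihomog_ne0 nD hXg) scaler0.
move=> j mu; rewrite mcoeff_msupp /h' raddf_sum /= => hmu.
apply/eqP; apply: contraNT hmu => nD; rewrite big1 // => nu /eqP nuD.
rewrite mcoeffZ mcoeffX; case: eqP => [e1|]; last by rewrite mulr0.
by rewrite -e1 nuD eqxx in nD.
Qed.

(** The module over the subring [k[g]] spanned by the monomials with all exponents below [M]. *)
Definition module_span M (p : {mpoly k[m]}) : Prop :=
  exists c : {ffun 'I_m -> 'I_M} -> {mpoly k[d]},
    p = \sum_mu mmap (@mpolyC m k) g (c mu) * \prod_i 'X_i ^+ mu i.

Lemma module_spanD M p q :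
  module_span M p -> module_span M q -> module_span M (p + q).
Proof.
move=> [c ->] [c' ->]; exists (fun mu => c mu + c' mu).
by rewrite -big_split /=; apply: eq_bigr => mu _; rewrite mmapD mulrDl.
Qed.

Lemma module_spanM M a p :
  module_span M p -> module_span M (mmap (@mpolyC m k) g a * p).
Proof.
move=> [c ->]; exists (fun mu => a * c mu).
by rewrite mulr_sumr; apply: eq_bigr => mu _; rewrite rmorphM mulrA.
Qed.

Lemma module_span_sum M (I : Type) (s : seq I) (P : pred I) F :
  (forall i, P i -> module_span M (F i)) ->
  module_span M (\sum_(i <- s | P i) F i).
Proof.
move=> h; apply: (big_ind (module_span M)) => //; last exact: module_spanD.
by exists (fun=> 0); rewrite big1 // => mu _; rewrite mmap0 mul0r.
Qed.

(** A graded Nakayama argument: a factor ['X_i ^+ M] of a monomial is replaced by a combination of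
    the [g j] with homogeneous cofactors, which have smaller degree because [e j > 0]; then induct
    on the degree. *)
Lemma module_spanT M : (forall i : 'I_m, in_ideal ('X_i ^+ M)) ->
  forall p, module_span M p.
Proof.
move=> hM p; have [s] := ubnP (msize p); elim: s p => // s IH p.
rewrite ltnS => ps; rewrite [p]mpolyE big_seq_cond.
apply: module_span_sum => mu; rewrite andbT => hmu.
rewrite -mul_mpolyC -(mmapC g (@mpolyC m k)); apply: module_spanM.
have {hmu} mus : (mdeg mu < s)%N by apply: leq_trans ps; exact: msize_mdeg_lt.
have [/forallP lt|] := boolP [forall i, (mu i < M)%N].
  exists (fun nu => (nu == [ffun i => Ordinal (lt i)])%:R).
  rewrite (bigD1 [ffun i => Ordinal (lt i)]) //= eqxx rmorph1 mul1r [X in _ + X]big1.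
    by rewrite addr0 mpolyXE_id; apply: eq_bigr => i _; rewrite ffunE.
  by move=> nu /negbTE ->; rewrite rmorph0 mul0r.
rewrite negb_forall => /existsP [i]; rewrite -leqNgt => Mi.
have XiM : ('X_i ^+ M : {mpoly k[m]}) \is M.-homog.
  by rewrite mpolyXn dhomogX /= mdegMn mdeg1 mul1n.
have [h hE hdeg] := in_ideal_homog XiM (hM i).
have leU : (U_(i) *+ M <= mu)%MM.
  apply/mnm_lepP => j; rewrite mulmnE mnm1E.
  by case: eqP => [<-|_]; rewrite ?mul1n ?mul0n.
have muE : mu = (mu - U_(i) *+ M + U_(i) *+ M)%MM by rewrite submK.
rewrite {1}muE mpolyXD -mpolyXn hE mulr_sumr; apply: module_span_sum => j _.
have -> : 'X_[(mu - U_(i) *+ M)] * (h j * g j) =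
    mmap (@mpolyC m k) g 'X_j * ('X_[(mu - U_(i) *+ M)] * h j).
  by rewrite mmapX mmap1U; ring.
apply/module_spanM/IH; rewrite msizeE; apply: leq_ltn_trans mus.
rewrite big_seq_cond; apply: (big_ind (fun x => (x <= mdeg mu)%N)) => //.
  by move=> x y hx hy; rewrite geq_max hx.
move=> nu; rewrite andbT => /msuppM_le /allpairsP [[nu1 nu2] /= [h1 h2 ->]].
move: h1; rewrite msuppX inE => /eqP ->.
have := congr1 (@mdeg m) muE; have := hdeg _ _ h2; have := e_gt0 j.
by rewrite !mdegD mdegMn mdeg1 mul1n; lia.
Qed.

Lemma indep_var : indep (@FracField.tofrac {mpoly k[m]} \o @mpolyC m k)
  (fun i => @FracField.tofrac {mpoly k[m]} 'X_i).
Proof.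
move=> p.
have -> : mmap (@FracField.tofrac {mpoly k[m]} \o @mpolyC m k)
    (fun i => @FracField.tofrac {mpoly k[m]} 'X_i) p = FracField.tofrac p.
  rewrite [p in RHS]mpolyE raddf_sum /=; apply: eq_bigr => mu _.
  rewrite -mul_mpolyC rmorphM /=; congr (_ * _).
  by rewrite mpolyXE_id rmorph_prod /=; apply: eq_bigr => i _; rewrite rmorphXn.
by move/eqP; rewrite tofrac_eq0 => /eqP.
Qed.

Lemma not_all_nilpotent : (d < m)%N ->
  ~ (forall i : 'I_m, exists M, in_ideal ('X_i ^+ M)).
Proof.
move=> dm /fin_all_exists [Ms hMs].
pose M := (\sum_i Ms i).+1.
have hM i : in_ideal ('X_i ^+ M).
  have le : (Ms i <= M)%N by rewrite /M (bigD1 i) //=; lia.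
  have [h hE] := hMs i; exists (fun j => 'X_i ^+ (M - Ms i) * h j).
  rewrite -{1}(subnK le) exprD hE mulr_sumr.
  by apply: eq_bigr => j _; rewrite mulrA.
have spanT := module_spanT hM.
pose B := {mpoly k[m]}; pose tf : {rmorphism B -> {fraction B}} := @FracField.tofrac B.
pose y (i : 'I_m) := tf 'X_i; pose b j := tf (g j).
pose emb : {rmorphism k -> {fraction B}} := tf \o @mpolyC m k.
suff alg i : algebraic_on emb b (y i).
  by have := indep_algebraic_on_leq indep_var alg; rewrite leqNgt dm.
pose T : finType := {ffun 'I_m -> 'I_M}.
pose mon (mu : T) : B := \prod_i 'X_i ^+ mu i.
have [c hc] := fin_all_exists (fun mu : T => spanT ('X_i * mon mu)).
(* Determinant trick: [A] describes multiplication by ['X_i] on the spanning monomials, so their row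
   is an eigenvector with eigenvalue ['X_i], and [char_poly A] is a monic equation for it. *)
pose A : 'M[{mpoly k[d]}]_#|T| := \matrix_(u, v) c (enum_val v) (enum_val u).
exists (char_poly A).
  by rewrite (monicP (char_poly_monic A)) rmorph1 oner_neq0.
rewrite map_char_poly -eigenvalue_root_char; apply/eigenvalueP.
have evE a : mmap emb b a = tf (mmap (@mpolyC m k) g a).
  rewrite /mmap raddf_sum /=; apply: eq_bigr => mu _; rewrite rmorphM.
  by congr (_ * _); rewrite rmorph_prod; apply: eq_bigr => j _; rewrite rmorphXn.
exists (\row_u tf (mon (enum_val u))).
  apply/rowP => v; rewrite !mxE -rmorphM /= hc.
  rewrite (reindex (enum_val : 'I_#|T| -> T)) /=; last first.
    exists enum_rank => u _; first by rewrite enum_valK.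
    by rewrite enum_rankK.
  rewrite rmorph_sum; apply: eq_bigr => u _.
  by rewrite !mxE evE rmorphM mulrC.
(* The monomial of exponent 0 equals 1, so the eigenvector is nonzero. *)
apply/eqP => /rowP /(_ (enum_rank [ffun=> ord0])); rewrite !mxE enum_rankK.
rewrite /mon big1 => [|j _]; last by rewrite ffunE expr0.
by move/eqP; rewrite rmorph1 oner_eq0.
Qed.

(* Otherwise the polynomial ring would be finite over the subring generated by
   the [d < m] forms. *)
Theorem forms_common_zero : (d < m)%N ->
  exists (K : fieldType) (emb : {rmorphism k -> K}) (c : 'I_m -> K),
    (forall j, mmap emb c (g j) = 0) /\ exists i, c i != 0.
Proof.
move=> dm; have [i hi] : exists i, forall M, ~ in_ideal ('X_i ^+ M).
  apply: contrapT => h; apply: (not_all_nilpotent dm) => i.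
  apply: contrapT => h'; apply: h; exists i => M hM; apply: h'.
  by exists M.
have [|||K [phi [phiJ phix]]] :=
    @rmorphism_to_field _ in_ideal 'X_i _ _ _ hi.
- by exists (fun=> 0); rewrite big1 // => j _; rewrite mul0r.
- move=> u v [h ->] [h' ->]; exists (fun j => h j + h' j).
  by rewrite -big_split; apply: eq_bigr => j _; rewrite mulrDl.
- move=> a u [h ->]; exists (fun j => a * h j).
  by rewrite mulr_sumr; apply: eq_bigr => j _; rewrite mulrA.
exists K, (phi \o @mpolyC m k : {rmorphism k -> K}), (fun i => phi 'X_i).
split; last by exists i.
move=> j; rewrite -(phiJ (g j)); last first.
  exists (fun l => (l == j)%:R); rewrite (bigD1 j) //= eqxx mul1r big1 ?addr0 //.
  by move=> l /negbTE ->; rewrite mul0r.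
rewrite [g j in RHS]mpolyE rmorph_sum; apply: eq_bigr => mu _.
rewrite -mul_mpolyC rmorphM /=; congr (_ * _).
by rewrite mpolyXE_id rmorph_prod; apply: eq_bigr => l _; rewrite rmorphXn.
Qed.

End CommonZero.

(** * Polynomials with prescribed double roots *)

Section DoubleRoots.
Variables (k : fieldType) (m : nat).

Definition weighted_prod (R : comNzRingType) (w : 'I_m -> nat) (c : 'I_m -> R) :
  {poly R} := \prod_i ('X - (c i)%:P) ^+ w i.

(** Homogeneity of total degree [D], the polynomial variable counting with degree 1; the additive
    form avoids a truncated subtraction. *)
Definition graded D (q : {poly {mpoly k[m]}}) : Prop :=
  forall i mu, mu \in msupp q`_i -> (mdeg mu + i = D)%N.

Lemma graded1 : graded 0 1.
Proof.
move=> i mu; rewrite coef1; case: i => [|i] /=; last by rewrite msupp0.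
by rewrite msupp1 inE addn0 => /eqP ->; rewrite mdeg0.
Qed.

Lemma gradedM D1 D2 p q : graded D1 p -> graded D2 q -> graded (D1 + D2) (p * q).
Proof.
move=> hp hq i mu; rewrite coefM mcoeff_msupp raddf_sum /= => h.
have [l hl] : exists l : 'I_i.+1, mu \in msupp (p`_l * q`_(i - l)).
  apply: contrapT => no; move/eqP: h; apply; apply: big1 => l _.
  by apply/memN_msupp_eq0/negP => hl; apply: no; exists l.
move/msuppM_le/allpairsP: hl => [[mu1 mu2] /= [/hp h1 /hq h2 ->]].
rewrite mdegD -h1 -h2; have := ltn_ord l; lia.
Qed.

Lemma gradedXsubC i : graded 1 ('X - ('X_i)%:P).
Proof.
move=> [|[|j]] mu; rewrite coefB coefX coefC /=.
- by rewrite sub0r (perm_mem (msuppN _)) msuppX inE => /eqP ->; rewrite mdeg1.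
- by rewrite subr0 msupp1 inE => /eqP ->; rewrite mdeg0.
by rewrite subr0 msupp0.
Qed.

Lemma graded_weighted_prod w :
  graded (\sum_i w i) (weighted_prod w (fun i => 'X_i)).
Proof.
rewrite /weighted_prod.
elim/big_ind2: _ => [|D p D' q|i _]; first exact: graded1.
  exact: gradedM.
elim: (w i) => [|a IH]; first exact: graded1.
by rewrite exprS -[a.+1]add1n; apply: gradedM => //; exact: gradedXsubC.
Qed.

Variables (K : fieldType) (w : 'I_m -> nat) (c : 'I_m -> K).
Hypothesis w_gt0 : forall i, (0 < w i)%N.
Let n := (\sum_i w i)%N.
Let Q := weighted_prod w c.

Lemma monic_weighted_prod : Q \is monic.
Proof. by apply: monic_prod => i _; apply/monic_exp/monicXsubC. Qed.

Lemma size_weighted_prod : size Q = n.+1.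
Proof.
rewrite /Q /weighted_prod size_prod => [|i _]; last first.
  by rewrite expf_neq0 // polyXsubC_eq0.
rewrite (eq_bigr (fun i => w i + 1)%N) => [|i _]; last first.
  by rewrite size_exp_XsubC addn1.
rewrite big_split /= -/n sum1_card. by rewrite subSn ?leq_addl // addnK.
Qed.

(** Each factor survives in the derivative with its exponent lowered by at most 1. Arguing factor by
    factor avoids assuming the [c i] distinct, which is still to be proved. *)
Lemma dvdp_deriv_prod (s : seq 'I_m) :
  (\prod_(i <- s) ('X - (c i)%:P) ^+ (w i).-1 %|
    (\prod_(i <- s) ('X - (c i)%:P) ^+ w i)^`())%R.
Proof.
elim: s => [|i s IH]; first by rewrite !big_nil derivC dvdp0.
rewrite !big_cons derivM dvdp_add //.
  rewrite dvdp_mul //.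
    by rewrite deriv_exp derivXsubC mul1r -mulr_natr dvdp_mulr.
  by apply: (big_ind2 (fun p q => p %| q)) => // [p p' q q'|j _];
    [exact: dvdp_mul | rewrite dvdp_exp2l ?leq_pred].
by rewrite dvdp_mul // dvdp_exp2l ?leq_pred.
Qed.

(* [X Q' - n Q] has degree at most [n - m], hence is a multiple of
   [prod (X - c_i)^(w_i - 1)]; comparing multiplicities at a repeated [c_i]
   gives a contradiction. *)
Lemma weighted_prod_distinct : [pchar K] =i pred0 ->
  (forall j, (n - m < j < n)%N -> Q`_j = 0) -> (exists i, c i != 0) ->
  injective c.
Proof.
move=> char0 Q0 [i0 ci0].
have natK0 a : (a%:R == 0 :> K) = (a == 0)%N by move/pcharf0P: char0 => ->.
have mn : (m <= n)%N.
  rewrite /n -[X in (X <= _)%N]card_ord -sum1_card; exact: leq_sum.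
pose H := 'X * Q^`() - n%:R *: Q.
have HE j : H`_j = (j%:R - n%:R) * Q`_j.
  rewrite coefB coefXM coefZ mulrBl; congr (_ - _).
  by case: j => [|j] /=; rewrite ?mul0r // coef_deriv mulr_natl.
have sH : (size H <= (n - m).+1)%N.
  apply/leq_sizeP => j hj; rewrite HE.
  have [jn|] := ltnP j n; first by rewrite Q0 ?mulr0 ?hj.
  rewrite leq_eqVlt => /orP [/eqP <-|jn]; first by rewrite subrr mul0r.
  by rewrite [Q`_j]nth_default ?mulr0 // size_weighted_prod.
(* The coefficients of [H] are [(j - n) * Q_j], so in characteristic 0 [H = 0] would force
   [Q = 'X^n] and every [c i = 0]. *)
have Hn0 : H != 0.
  apply: contra ci0 => /eqP H0.
  have QX : Q = 'X^n.
    apply/polyP => j; rewrite coefXn.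
    case: (ltngtP j n) => [jn|jn|->].
    - have := HE j; rewrite H0 coef0 => /esym/eqP; rewrite mulf_eq0.
      rewrite -opprB oppr_eq0 -natrB ?(ltnW jn) // natK0 subn_eq0 leqNgt jn /=.
      by move/eqP.
    - by rewrite nth_default // size_weighted_prod.
    by have := monic_weighted_prod; rewrite monicE lead_coefE size_weighted_prod => /eqP.
  have : root Q (c i0).
    rewrite /Q /weighted_prod (bigD1 i0) //= rootM -(prednK (w_gt0 i0)).
    by rewrite root_exp_XsubC eqxx.
  by rewrite QX /root hornerXn expf_eq0 => /andP [_].
pose U := weighted_prod (fun i => (w i).-1) c.
have UQ : (U %| Q)%R.
  by apply: (big_ind2 (fun p q => p %| q)) => // [p p' q q'|j _];
    [exact: dvdp_mul | rewrite dvdp_exp2l ?leq_pred].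
have UH : (U %| H)%R.
  apply: dvdp_sub; last by rewrite -mul_polyC dvdp_mull.
  by apply: dvdp_mull; exact: dvdp_deriv_prod.
have sU : size U = (n - m).+1.
  rewrite /U /weighted_prod size_prod => [|i _]; last first.
    by rewrite expf_neq0 // polyXsubC_eq0.
  rewrite (eq_bigr w) => [|i _]; last by rewrite size_exp_XsubC prednK.
  by rewrite card_ord -/n subSn.
(* [U] divides [H], and its degree [n - m] bounds the degree of [H], so the two are associate. *)
have HU : (H %| U)%R.
  have : (U %= H)%R.
    rewrite -dvdp_size_eqp //; apply/eqP/anti_leq.
    by rewrite dvdp_leq //= sU.
  by rewrite /eqp => /andP [].
move=> i j cij; apply/eqP; apply: contraT => ij; exfalso.
pose ga := c i.
have splitE v : weighted_prod v c = ('X - ga%:P) ^+ (\sum_(l | c l == ga) v l) *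
    \prod_(l | c l != ga) ('X - (c l)%:P) ^+ v l.
  rewrite /weighted_prod (bigID (fun l => c l == ga)) /=; congr (_ * _).
  rewrite -prodrXr; apply: eq_bigr => l /eqP -> //.
(* [a] is the multiplicity of [ga] in [U]. Since [i] and [j] both contribute, the multiplicity in
   [Q] is at least [a + 2], hence at least [a + 1] in [H], against [H %| U]. *)
pose a := (\sum_(l | c l == ga) (w l).-1)%N.
have wa : (\sum_(l | c l == ga) w l >= a.+2)%N.
  rewrite /a !(bigD1 i (P := fun l => c l == ga)) //=.
  rewrite !(bigD1 j (P := fun l => (c l == ga) && (l != i))) /=; last 2 first.
  - by rewrite /ga cij eqxx eq_sym.
  - by rewrite /ga cij eqxx eq_sym.
  have arith u v x y : (0 < u)%N -> (0 < v)%N -> (x <= y)%N ->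
    ((u.-1 + (v.-1 + x)).+1 < u + (v + y))%N by lia.
  by apply: arith => //; apply: leq_sum => l _; exact: leq_pred.
have QE := splitE w.
have d1 : (('X - ga%:P) ^+ a.+1 %| H)%R.
  apply: dvdp_sub; last first.
    by rewrite -mul_polyC dvdp_mull // /Q QE dvdp_mulr // dvdp_exp2l // ltnW.
  apply: dvdp_mull; rewrite /Q QE derivM dvdp_add //.
    rewrite dvdp_mulr // deriv_exp derivXsubC mul1r -mulr_natr dvdp_mulr //.
    by rewrite dvdp_exp2l // -ltnS (leq_trans wa) // leqSpred.
  by rewrite dvdp_mulr // dvdp_exp2l // ltnW.
have := dvdp_trans d1 HU.
rewrite /U splitE -/a exprSr dvdp_mul2l ?expf_neq0 ?polyXsubC_eq0 //.
rewrite dvdp_XsubCl /root horner_prod prodf_seq_eq0 => /hasP [l _ /=].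
move=> /andP [cl]; rewrite -/(root _ _); case: (w l).-1 => [|x].
  by rewrite expr0 (negbTE (root1 _)).
by rewrite root_exp_XsubC eq_sym (negbTE cl).
Qed.

End DoubleRoots.

(** For indeterminate roots, the [m - 1] coefficients to be killed are forms of degrees
    [1, ..., m - 1] in [m] variables, so they have a common nonzero zero. *)
Lemma exists_sparse_weighted_prod (k : fieldType) (m : nat) (w : 'I_m -> nat) :
  [pchar k] =i pred0 -> (0 < m)%N -> (forall i, 0 < w i)%N ->
  let n := (\sum_i w i)%N in
  exists (K : fieldType) (emb : {rmorphism k -> K}) (c : 'I_m -> K),
    injective c /\
    forall j, (n - m < j < n)%N -> (weighted_prod w c)`_j = 0.
Proof.
move=> char0 m0 w0 n; pose Q := weighted_prod w (fun i => 'X_i : {mpoly k[m]}).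
have gH (j : 'I_m.-1) : Q`_(n - j.+1) \is j.+1.-homog.
  apply/dhomogP => mu /graded_weighted_prod; rewrite -/n /=.
  have : (m <= n)%N.
    rewrite /n -[X in (X <= _)%N]card_ord -sum1_card; exact: leq_sum.
  by have := ltn_ord j; lia.
have [//||K [emb [c [gc [i ci]]]]] := forms_common_zero gH; first by rewrite ltn_predL.
have QE : weighted_prod w c = map_poly (mmap emb c) Q.
  rewrite /weighted_prod rmorph_prod; apply: eq_bigr => l _.
  by rewrite rmorphXn rmorphB /= map_polyX map_polyC /= mmapX mmap1U.
have Q0 j : (n - m < j < n)%N -> (weighted_prod w c)`_j = 0.
  move=> /andP [h1 h2]; rewrite QE coef_map /=.
  have h : ((n - j).-1 < m.-1)%N by lia.
  by have := gc (Ordinal h); rewrite /= (_ : n - (n - j).-1.+1 = j)%N //; lia.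
exists K, emb, c; split=> //; apply: (weighted_prod_distinct w0 _ Q0); last by exists i.
by move=> p; rewrite (fmorph_pchar emb) char0.
Qed.

(** * Power series in several variables *)

Definition mps (K : fieldType) (N : nat) : Type := 'X_{1..N} -> K.

HB.instance Definition _ K N := gen_eqMixin (mps K N).
HB.instance Definition _ K N := gen_choiceMixin (mps K N).

Section MpsRing.
Variables (K : fieldType) (N : nat).
Implicit Types (f g h : mps K N) (m : 'X_{1..N}) (p q : {mpoly K[N]}).

Definition mps_trunc d f : {mpoly K[N]} :=
  \sum_(m : 'X_{1..N < d.+1}) f m *: 'X_[m].

Definition mps_agree d p f : Prop := forall m, (mdeg m <= d)%N -> p@_m = f m.

Lemma mps_truncP d f : mps_agree d (mps_trunc d f) f.
Proof. by move=> m md; rewrite /mps_trunc mcoeff_mpoly. Qed.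

Definition mps_zero : mps K N := fun=> 0.
Definition mps_one : mps K N := fun m => (m == 0%MM)%:R.
Definition mps_opp f : mps K N := fun m => - f m.
Definition mps_add f g : mps K N := fun m => f m + g m.
(* Products are computed on truncations, so the ring axioms reduce to those of
   [{mpoly K[N]}]. *)
Definition mps_mul f g : mps K N :=
  fun m => (mps_trunc (mdeg m) f * mps_trunc (mdeg m) g)@_m.

Lemma mps_mulE d p q f g : mps_agree d p f -> mps_agree d q g ->
  mps_agree d (p * q) (mps_mul f g).
Proof.
move=> hp hq m md; rewrite /mps_mul !mcoeffM; apply: eq_bigr => -[m1 m2] /= /eqP e.
have : (mdeg m1 + mdeg m2 = mdeg m)%N by rewrite -mdegD -e.
move=> e'; rewrite hp ?hq ?mps_truncP //; lia.
Qed.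

Lemma mps_addA : associative mps_add.
Proof. by move=> f g h; apply/funext => m; rewrite /mps_add addrA. Qed.
Lemma mps_addC : commutative mps_add.
Proof. by move=> f g; apply/funext => m; rewrite /mps_add addrC. Qed.
Lemma mps_add0 : left_id mps_zero mps_add.
Proof. by move=> f; apply/funext => m; rewrite /mps_add add0r. Qed.
Lemma mps_addN : left_inverse mps_zero mps_opp mps_add.
Proof. by move=> f; apply/funext => m; rewrite /mps_add addNr. Qed.

HB.instance Definition _ :=
  GRing.isZmodule.Build (mps K N) mps_addA mps_addC mps_add0 mps_addN.

Lemma mps_mulA : associative mps_mul.
Proof.
move=> f g h; apply/funext => m; pose t := @mps_truncP (mdeg m).
rewrite -(mps_mulE (t f) (mps_mulE (t g) (t h)) (leqnn _)).
by rewrite -(mps_mulE (mps_mulE (t f) (t g)) (t h) (leqnn _)) mulrA.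
Qed.
Lemma mps_mulC : commutative mps_mul.
Proof. by move=> f g; apply/funext => m; rewrite /mps_mul mulrC. Qed.
Lemma mps_mul1 : left_id mps_one mps_mul.
Proof.
move=> f; apply/funext => m; pose t := @mps_truncP (mdeg m).
have one : mps_agree (mdeg m) 1 mps_one by move=> m' _; rewrite mcoeff1.
by rewrite -(mps_mulE one (t f) (leqnn _)) mul1r t.
Qed.
Lemma mps_mulDl : left_distributive mps_mul mps_add.
Proof.
move=> f g h; apply/funext => m; pose t := @mps_truncP (mdeg m).
have fg : mps_agree (mdeg m) (mps_trunc (mdeg m) f + mps_trunc (mdeg m) g) (mps_add f g).
  by move=> m' hm'; rewrite mcoeffD !t.
by rewrite -(mps_mulE fg (t h) (leqnn _)) mulrDl mcoeffD.
Qed.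
Lemma mps_one_neq0 : mps_one != mps_zero.
Proof.
apply/eqP => /(congr1 (fun f : mps K N => f 0%MM)) /eqP.
by rewrite /mps_one eqxx oner_eq0.
Qed.

HB.instance Definition _ := GRing.Zmodule_isComNzRing.Build (mps K N)
  mps_mulA mps_mulC mps_mul1 mps_mulDl mps_one_neq0.

Lemma mpsD f g m : (f + g) m = f m + g m. Proof. by []. Qed.
Lemma mpsN f m : (- f) m = - f m. Proof. by []. Qed.
Lemma mpsB f g m : (f - g) m = f m - g m. Proof. by []. Qed.
Lemma mps0 m : (0 : mps K N) m = 0. Proof. by []. Qed.
Lemma mps1 m : (1 : mps K N) m = (m == 0%MM)%:R. Proof. by []. Qed.

Lemma mpsM f g m : (f * g) m =
  \sum_(q : 'X_{1..N < (mdeg m).+1, (mdeg m).+1} | m == (q.1 + q.2)%MM)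
    f q.1 * g q.2.
Proof.
rewrite [LHS]/(mps_mul f g m) /mps_mul mcoeffM; apply: eq_bigr => -[m1 m2] /= /eqP e.
have e' : (mdeg m1 + mdeg m2 = mdeg m)%N by rewrite -mdegD -e.
by rewrite !mps_truncP //; lia.
Qed.

Lemma mps_sum (I : Type) (r : seq I) (P : pred I) (F : I -> mps K N) m :
  (\sum_(i <- r | P i) F i) m = \sum_(i <- r | P i) F i m.
Proof. by apply: (big_morph (fun f : mps K N => f m)). Qed.

Definition mps_of_mpoly p : mps K N := fun m => p@_m.

Lemma mps_of_mpoly_zmod : zmod_morphism mps_of_mpoly.
Proof. by move=> p q; apply/funext => m; rewrite /mps_of_mpoly mcoeffB. Qed.
Lemma mps_of_mpoly_monoid : monoid_morphism mps_of_mpoly.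
Proof.
split=> [|p q]; apply/funext => m; first by rewrite /mps_of_mpoly mcoeff1.
by rewrite /mps_of_mpoly mpsM mcoeffM.
Qed.
HB.instance Definition _ := GRing.isZmodMorphism.Build {mpoly K[N]} (mps K N)
  mps_of_mpoly mps_of_mpoly_zmod.
HB.instance Definition _ := GRing.isMonoidMorphism.Build {mpoly K[N]} (mps K N)
  mps_of_mpoly mps_of_mpoly_monoid.

Definition mpsC : {rmorphism K -> mps K N} := mps_of_mpoly \o @mpolyC N K.

Definition mps_cst f : K := f 0%MM.

Lemma mps_cst_zmod : zmod_morphism mps_cst. Proof. by []. Qed.
Lemma mps_cst_monoid : monoid_morphism mps_cst.
Proof.
split=> [|f g]; first by rewrite /mps_cst mps1 eqxx.
rewrite {1}/mps_cst mpsM mdeg0 (bigD1 (bm0, bm0)) /=; last first.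
  by rewrite addm0.
rewrite big1 ?addr0 // => -[m1 m2] /= /andP [/eqP /esym/eqP].
rewrite mnmD_eq0 => /andP [/eqP e1 /eqP e2] /negP []; apply/eqP.
by congr (_, _); apply: val_inj.
Qed.
HB.instance Definition _ := GRing.isZmodMorphism.Build (mps K N) K
  mps_cst mps_cst_zmod.
HB.instance Definition _ := GRing.isMonoidMorphism.Build (mps K N) K
  mps_cst mps_cst_monoid.

(** The lowest term for the monomial order; a power series need not have a highest one. *)
Definition mps_lead f m : Prop :=
  f m != 0 /\ forall m', (m' < m)%O -> f m' = 0.

Lemma mps_lead_exists f : f != 0 -> exists m, mps_lead f m.
Proof.
move=> f0; apply: contrapT => no; move/eqP: f0; apply; apply/funext => m.
elim/(@ltmwf N): m => m IH; apply/eqP; apply: contraT => fm.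
by case: no; exists m.
Qed.

(** The order is compatible with addition of exponents, so [(m, m')] is the only pair contributing
    at [m + m'] and no pair contributes below. *)
Lemma mps_leadM f g m m' : mps_lead f m -> mps_lead g m' ->
  mps_lead (f * g) (m + m')%MM /\ (f * g) (m + m')%MM = f m * g m'.
Proof.
move=> [fm flt] [gm glt].
have split m1 m2 : ((m1 + m2)%MM <= (m + m')%MM)%O -> f m1 * g m2 != 0 -> m1 = m /\ m2 = m'.
  move=> le; rewrite mulf_eq0 negb_or => /andP [f1 g2].
  have le1 : (m <= m1)%O.
    by rewrite leNgt; apply: contra f1 => /flt ->.
  have le2 : (m' <= m2)%O.
    by rewrite leNgt; apply: contra g2 => /glt ->.
  have e1 : m1 = m.
    apply/eqP; rewrite eq_le le1 andbT leNgt; apply/negP => lt.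
    by have := ltmc_le_add lt le2; rewrite ltNge le.
  split=> //; move: le; rewrite e1 lemc_add2r => le.
  by apply/eqP; rewrite eq_le le le2.
have E : (f * g) (m + m')%MM = f m * g m'.
  rewrite mpsM.
  have h1 : (mdeg m < (mdeg (m + m')).+1)%N by rewrite ltnS mdegD leq_addr.
  have h2 : (mdeg m' < (mdeg (m + m')).+1)%N by rewrite ltnS mdegD leq_addl.
  rewrite (bigD1 (BMultinom h1, BMultinom h2)) //= big1 ?addr0 //.
  move=> [m1 m2] /= /andP [/eqP e ne]; apply/eqP; apply: contraNT ne => ne.
  have [|e1 e2] := split m1 m2 _ ne; first by rewrite -e.
  by apply/eqP; congr (_, _); apply: val_inj.
split=> //; split; first by rewrite E mulf_neq0.
move=> m0 lt; rewrite mpsM big1 // => -[m1 m2] /= /eqP e.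
apply/eqP; apply: contraT => ne.
have [|e1 e2] := split m1 m2 _ ne; first by rewrite -e ltW.
by move: lt; rewrite e e1 e2 ltxx.
Qed.

Lemma mps_domain f g : f * g = 0 -> (f == 0) || (g == 0).
Proof.
move=> fg; apply: contraT; rewrite negb_or => /andP [].
move=> /mps_lead_exists [m fm] /mps_lead_exists [m' gm].
by have [[]] := mps_leadM fm gm; rewrite fg mps0 eqxx.
Qed.

HB.instance Definition _ := GRing.ComNzRing_hasMulInverse.Build (mps K N)
  (@some_invP (mps K N)) (@has_inv_intro (mps K N)) (@some_inv_out (mps K N)).
HB.instance Definition _ :=
  GRing.ComUnitRing_isIntegral.Build (mps K N) mps_domain.

(** The filtration by order of vanishing at the origin, used as the metric in the fixed point
    lemmas. *)
Definition mps_ord_ge d f : Prop := forall m, (mdeg m < d)%N -> f m = 0.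

Lemma mps_ord_geD d f g : mps_ord_ge d f -> mps_ord_ge d g -> mps_ord_ge d (f + g).
Proof. by move=> hf hg m md; rewrite mpsD hf ?hg ?addr0. Qed.

Lemma mps_ord_geN d f : mps_ord_ge d f -> mps_ord_ge d (- f).
Proof. by move=> hf m md; rewrite mpsN hf ?oppr0. Qed.

Lemma mps_ord_ge_leq d d' f : (d' <= d)%N -> mps_ord_ge d f -> mps_ord_ge d' f.
Proof. by move=> le hf m md; apply: hf; apply: leq_trans le. Qed.

Lemma mps_ord_geM a b f g :
  mps_ord_ge a f -> mps_ord_ge b g -> mps_ord_ge (a + b) (f * g).
Proof.
move=> hf hg m md; rewrite mpsM big1 // => -[m1 m2] /= /eqP e.
have e' : (mdeg m1 + mdeg m2 = mdeg m)%N by rewrite -mdegD -e.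
have [lt|ge] := ltnP (mdeg m1) a; first by rewrite hf ?mul0r.
by rewrite hg ?mulr0 //; lia.
Qed.

Lemma mps_ord_ge1 f : mps_ord_ge 1 f <-> mps_cst f = 0.
Proof.
split=> [h|h m]; first by apply: h; rewrite mdeg0.
by rewrite ltnS leqn0 mdeg_eq0 => /eqP ->.
Qed.

Lemma mps_ord_ge_eq0 f : (forall d, mps_ord_ge d f) -> f = 0.
Proof. by move=> h; apply/funext => m; apply: (h (mdeg m).+1). Qed.

(** In degree at least 2, the difference of powers is [f - g] times a series without constant term;
    in degree 1 the coefficient of [psi] has none. So [psi] is a contraction for the adic
    topology. *)
Lemma mps_contract (psi : {poly mps K N}) d f g :
  mps_cst psi`_1 = 0 -> mps_ord_ge 1 f -> mps_ord_ge 1 g ->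
  mps_ord_ge d (f - g) -> mps_ord_ge d.+1 (psi.[f] - psi.[g]).
Proof.
move=> psi1 hf hg hfg; rewrite !horner_coef -sumrB.
apply: (big_ind (mps_ord_ge d.+1)) => // [f' g'|i _]; first exact: mps_ord_geD.
rewrite -mulrBr; case: (nat_of_ord i) => [|[|j]].
- by rewrite !expr0 subrr mulr0.
- by rewrite !expr1 -add1n; apply: mps_ord_geM => //; apply/mps_ord_ge1.
rewrite -[d.+1]add0n; apply: mps_ord_geM => //; rewrite subrXX -addn1.
apply: mps_ord_geM => //; apply/mps_ord_ge1; rewrite rmorph_sum /= big1 // => l _.
move/mps_ord_ge1: hf => hf; move/mps_ord_ge1: hg => hg.
rewrite rmorphM !rmorphXn /= hf hg !expr0n.
by case: l => [[|l] hl]; rewrite /= ?subn0 /= ?mul0r ?mulr0.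
Qed.

Lemma mps_fixpoint_unique (psi : {poly mps K N}) f g :
  mps_cst psi`_1 = 0 -> mps_cst f = 0 -> mps_cst g = 0 ->
  psi.[f] = f -> psi.[g] = g -> f = g.
Proof.
move=> psi1 /mps_ord_ge1 hf /mps_ord_ge1 hg ff gg; apply/eqP; rewrite -subr_eq0.
apply/eqP/mps_ord_ge_eq0; elim=> [|d IH] //.
by rewrite -ff -gg; apply: mps_contract.
Qed.

Lemma mps_fixpoint_exists (psi : {poly mps K N}) :
  mps_cst psi`_0 = 0 -> mps_cst psi`_1 = 0 ->
  exists f, mps_cst f = 0 /\ psi.[f] = f.
Proof.
move=> psi0 psi1; pose y j := iter j (horner psi) 0.
have y1 j : mps_ord_ge 1 (y j).
  apply/mps_ord_ge1; elim: j => [|j IH] /=; first by rewrite rmorph0.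
  by rewrite -horner_map /= IH horner_coef0 coef_map.
have ystep j : mps_ord_ge j.+1 (y j.+1 - y j).
  elim: j => [|j IH]; first by apply: mps_ord_geD => //; exact: mps_ord_geN.
  exact: (mps_contract psi1 (y1 _) (y1 _) IH).
have ydist j l : mps_ord_ge j.+1 (y (l + j)%N - y j).
  elim: l => [|l IH]; first by rewrite subrr.
  rewrite -(subrKA (y (l + j)%N)); apply: mps_ord_geD => //.
  by apply: (mps_ord_ge_leq _ (ystep _)); rewrite ltnS leq_addl.
(* The coefficients of [y j] of degree at most [j] are final, so the limit can be read off
   diagonally. *)
pose f : mps K N := fun m => y (mdeg m) m.
have fy j : mps_ord_ge j.+1 (f - y j).
  move=> m; rewrite ltnS => mj; rewrite mpsB /f.
  have := ydist (mdeg m) (j - mdeg m)%N m (leqnn _); rewrite subnK // mpsB.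
  by move/eqP; rewrite subr_eq0 => /eqP ->; rewrite subrr.
have f1 : mps_ord_ge 1 f.
  rewrite -[f](subrK (y 0%N)); apply: mps_ord_geD => //; exact: fy.
exists f; split; first exact/mps_ord_ge1.
apply/eqP; rewrite -subr_eq0; apply/eqP/mps_ord_ge_eq0 => j.
rewrite -(subrKA (psi.[y j])); apply: mps_ord_geD.
  apply: (mps_ord_ge_leq (leqW (leqnSn j))); apply: mps_contract => //; exact: fy.
rewrite -opprB; apply: mps_ord_geN.
apply: (mps_ord_ge_leq (leqW (leqnSn j))); exact: (fy j.+1).
Qed.

Section Sign.
Variable i : 'I_N.

(** The reflection that substitutes [- s_i] for [s_i], written on coefficients. *)
Definition mps_sign f : mps K N := fun m => (-1) ^+ m i * f m.

Lemma mps_sign_zmod : zmod_morphism mps_sign.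
Proof. by move=> f g; apply/funext => m; rewrite /mps_sign mpsB mulrBr. Qed.
Lemma mps_sign_monoid : monoid_morphism mps_sign.
Proof.
split=> [|f g]; apply/funext => m.
  rewrite /mps_sign mps1; case: eqP => [->|]; last by rewrite mulr0.
  by rewrite mnm0E mul1r.
rewrite /mps_sign !mpsM mulr_sumr; apply: eq_bigr => -[m1 m2] /= /eqP e.
by rewrite mulrACA -exprD -mnmDE -e.
Qed.
HB.instance Definition _ := GRing.isZmodMorphism.Build (mps K N) (mps K N)
  mps_sign mps_sign_zmod.
HB.instance Definition _ := GRing.isMonoidMorphism.Build (mps K N) (mps K N)
  mps_sign mps_sign_monoid.

Lemma mps_signK : involutive mps_sign.
Proof. by move=> f; apply/funext => m; rewrite /mps_sign signrMK. Qed.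

Lemma mps_sign_inj : injective mps_sign.
Proof. exact: inv_inj mps_signK. Qed.

Lemma mps_sign_lead f m : mps_lead f m -> mps_lead (mps_sign f) m.
Proof.
move=> [fm lt]; split=> [|m' /lt h]; last by rewrite /mps_sign h mulr0.
by rewrite /mps_sign mulf_neq0 // signr_eq0.
Qed.

Lemma mps_sign_mpolyX j : mps_sign (mps_of_mpoly 'X_j) =
  (-1) ^+ (j == i) * mps_of_mpoly 'X_j.
Proof.
apply/funext => m; rewrite -signr_odd.
have -> : (-1) ^+ odd (j == i) * mps_of_mpoly 'X_j =
    (-1) ^+ (j == i) * mps_of_mpoly 'X_j :> mps K N by case: (j == i).
have sgE (b : bool) f m' : ((-1) ^+ b * f) m' = (-1) ^+ b * f m'.
  by case: b; rewrite ?mulN1r ?expr0 ?mul1r.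
rewrite sgE /mps_sign /mps_of_mpoly mcoeffX.
by case: eqP => [<-|]; [rewrite mnm1E | rewrite !mulr0].
Qed.

Lemma mps_signC c : mps_sign (mpsC c) = mpsC c.
Proof.
apply/funext => m; rewrite /mps_sign /= /mps_of_mpoly mcoeffC.
by case: eqP => [->|]; [rewrite mnm0E mul1r | rewrite !mulr0].
Qed.

End Sign.

Lemma mps_signCA i j f : mps_sign i (mps_sign j f) = mps_sign j (mps_sign i f).
Proof. by apply/funext => m; rewrite /mps_sign mulrCA. Qed.

Lemma mps_cst_sign i f : mps_cst (mps_sign i f) = mps_cst f.
Proof. by rewrite /mps_cst /mps_sign mnm0E mul1r. Qed.

Lemma mps_cstC c : mps_cst (mpsC c) = c.
Proof. by rewrite /mps_cst /= /mps_of_mpoly mcoeffC eqxx mulr1. Qed.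

End MpsRing.

(** * Splitting the double roots *)

Section Deformation.
Variables (K : fieldType) (r n : nat) (Q : {poly K}).
Let N := r.+1.
Let S := mps K N.
Variables (node gam : 'I_r.+1 -> K).
Hypothesis node_inj : injective node.
Hypothesis gam_neq0 : forall j, gam j != 0.

Let C : {rmorphism K -> S} := mpsC K N.
Let s (i : 'I_N) : S := mps_of_mpoly 'X_i.

Lemma cst_s i : mps_cst (s i) = 0.
Proof. by rewrite /mps_cst /s /mps_of_mpoly mcoeffX mnm1_eq0. Qed.

Lemma s_neq0 i : s i != 0.
Proof.
apply/eqP => /(congr1 (fun f : S => f U_(i)%MM)) /eqP.
by rewrite /s /mps_of_mpoly mcoeffX eqxx oner_eq0.
Qed.

Lemma sign_s i j : mps_sign i (s j) = (-1) ^+ (j == i) * s j.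
Proof. exact: mps_sign_mpolyX. Qed.

Lemma sign_s2 i j : mps_sign i (s j ^+ 2) = s j ^+ 2.
Proof. by rewrite rmorphXn /= sign_s; case: (j == i); rewrite ?mulN1r ?sqrrN ?mul1r. Qed.

(** Even in every variable, hence fixed by all reflections, and divisible by each [s j ^+ 2], so
    that the rescaled equations for the roots have power series coefficients. *)
Definition scale : S := \prod_j s j ^+ 2.
Let T := scale.

Lemma sign_scale i : mps_sign i T = T.
Proof. by rewrite rmorph_prod /=; apply: eq_bigr => j _; rewrite sign_s2. Qed.

Lemma scale_neq0 : T != 0.
Proof. by apply/prodf_neq0 => j _; rewrite expf_neq0 ?s_neq0. Qed.

Definition param (j : 'I_N) : S := T ^+ 2 * s j ^+ 2.

Definition lagr (j : 'I_N) : {poly K} :=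
  (\prod_(l | l != j) (node j - node l))^-1 *:
  \prod_(l | l != j) ('X - (node l)%:P).

Lemma lagr_node j l : (lagr j).[node l] = (l == j)%:R.
Proof.
rewrite /lagr hornerZ horner_prod.
case: eqP => [->|/eqP lj].
  rewrite [X in _ * X](eq_bigr (fun l => node j - node l)) => [|i _]; last first.
    exact: hornerXsubC.
  rewrite mulVf //; apply/prodf_neq0 => i ij.
  by rewrite subr_eq0 (inj_eq node_inj) eq_sym.
by rewrite [X in _ * X](bigD1 l) //= hornerXsubC subrr mul0r mulr0.
Qed.

Lemma size_lagr j : (size (lagr j) <= N)%N.
Proof.
apply: leq_trans (size_scale_leq _ _) _.
rewrite size_prod => [|i _]; last by rewrite polyXsubC_eq0.
under eq_bigr => i _ do rewrite size_XsubC.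
by rewrite sum_nat_const cardC1 card_ord /N /=; lia.
Qed.

(** A Lagrange interpolant of degree at most [r]. Near a double root [c] of [Q] with cofactor value
    [gam], the equation becomes [(x - c)^2 = T^2 s^2] to leading order. The node beyond the [r]
    double roots frees the last of the [r + 1] low coefficients. *)
Definition perturb : {poly S} :=
  \sum_j (- C (gam j) * s j ^+ 2) *: map_poly C (lagr j).

Lemma perturb_node j : perturb.[C (node j)] = - C (gam j) * s j ^+ 2.
Proof.
rewrite /perturb horner_sum (bigD1 j) //= big1 => [|l lj].
  by rewrite addr0 hornerZ horner_map lagr_node eqxx rmorph1 mulr1.
by rewrite hornerZ horner_map lagr_node eq_sym (negbTE lj) rmorph0 mulr0.
Qed.

Lemma size_perturb : (size perturb <= N)%N.
Proof.
apply: leq_trans (size_sum _ _ _) _; apply/bigmax_leqP => j _.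
apply: leq_trans (size_scale_leq _ _) _.
by rewrite size_map_poly size_lagr.
Qed.

Definition deformed : {poly S} := map_poly C Q + T ^+ 2 *: perturb.
Let f := deformed.

Lemma sign_deformed i : map_poly (mps_sign i) f = f.
Proof.
have mapC p : map_poly (mps_sign i) (map_poly C p) = map_poly C p.
  by apply/polyP => l; rewrite !coef_map /= mps_signC.
rewrite rmorphD /= mapC; congr (_ + _).
rewrite map_polyZ rmorphXn /= sign_scale; congr (_ *: _).
rewrite rmorph_sum; apply: eq_bigr => j _.
by rewrite /= map_polyZ mapC rmorphM rmorphN /= mps_signC sign_s2.
Qed.

(** The descending index matches the numbering of the variables in [f_poly]. *)
Definition coefs (l : 'I_N) : S := f`_(r - l).

Lemma sign_coefs i l : mps_sign i (coefs l) = coefs l.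
Proof. by rewrite /coefs -{2}(sign_deformed i) coef_map. Qed.

(** The [param j] are monomials, and distinct products of them are distinct monomials, so nothing
    cancels. *)
Lemma param_indep (p : {mpoly K[N]}) : mmap C param p = 0 -> p = 0.
Proof.
pose mu (j : 'I_N) : 'X_{1..N} := [multinom (if l == j then 6 else 4)%N | l < N].
have paramE j : param j = mps_of_mpoly 'X_[mu j].
  rewrite mpolyXE_id rmorph_prod /= /param /scale expr2 -big_split /=.
  rewrite [RHS](bigD1 j) //= [X in X * _](bigD1 j) //= [LHS]mulrAC; congr (_ * _).
    by rewrite mnmE eqxx rmorphXn /= -/(s j); ring.
  by apply: eq_bigr => l /negbTE lj; rewrite mnmE lj rmorphXn /= -/(s l); ring.
(* The sum of these exponents is [(2 + 4 * N) * mdeg m], which determines [mdeg m] and then every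
   [m l]. *)
pose E (m : 'X_{1..N}) : 'X_{1..N} := [multinom (m l).*2 + 4 * mdeg m | l < N].
have Einj : injective E.
  move=> m m' /mnmP h; have h' l : ((m l).*2 + 4 * mdeg m = (m' l).*2 + 4 * mdeg m')%N.
    by have := h l; rewrite !mnmE.
  have dE (m0 : 'X_{1..N}) : (\sum_l ((m0 l).*2 + 4 * mdeg m0) = (2 + 4 * N) * mdeg m0)%N.
    rewrite big_split /= sum_nat_const card_ord.
    by under eq_bigr => l _ do rewrite -muln2; rewrite -big_distrl /= -mdegE; lia.
  have d : mdeg m = mdeg m'.
    by apply/eqP; rewrite -(eqn_pmul2l (m := 2 + 4 * N)) // -!dE; apply/eqP/eq_bigr.
  by apply/mnmP => l; have := h' l; rewrite d; lia.
have XE (m : 'X_{1..N}) : mmap1 param m = mps_of_mpoly 'X_[E m].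
  rewrite /mmap1; under eq_bigr => j _ do rewrite paramE -rmorphXn /= mpolyXn.
  rewrite -rmorph_prod /= mprodXE; congr (mps_of_mpoly 'X_[_]).
  apply/mnmP => l; rewrite mnm_sumE mnmE.
  rewrite (eq_bigr (fun j => ((l == j) * (m j).*2 + 4 * m j)%N)) => [|j _].
    rewrite big_split /= -big_distrr /= -mdegE (bigD1 l) //= eqxx mul1n.
    by rewrite big1 ?addn0 // => j /negbTE jl; rewrite eq_sym jl.
  by rewrite mulmnE mnmE; case: eqP => _; lia.
move=> h; apply/mpolyP => m; rewrite mcoeff0.
have := congr1 (fun u : S => u (E m)) h; rewrite mps0 => <-.
have -> : mmap C param p = mps_of_mpoly (\sum_(m <- msupp p) p@_m *: 'X_[E m]).
  rewrite rmorph_sum /=; apply: eq_bigr => m' _.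
  by rewrite XE -mul_mpolyC rmorphM.
rewrite /mps_of_mpoly raddf_sum /=.
under eq_bigr => m' _ do rewrite mcoeffZ mcoeffX (inj_eq Einj).
have [mp|mp] := boolP (m \in msupp p); last first.
  rewrite (memN_msupp_eq0 mp) big_seq_cond big1 // => m'; rewrite andbT => hm'.
  by case: eqP => [e|]; rewrite ?mulr0 // -e hm' in mp *.
rewrite (bigD1_seq m) ?msupp_uniq //= eqxx mulr1 big1 ?addr0 //.
by move=> m' /negbTE ->; rewrite mulr0.
Qed.

(* The coefficients are an invertible affine image of the monomials [param]. *)
Lemma coefs_indep (k : fieldType) (emb : {rmorphism k -> K}) (p : {mpoly k[N]}) :
  mmap (C \o emb) coefs p = 0 -> p = 0.
Proof.
(* [B] interpolates and [B'] evaluates at the nodes, with the factors [- gam j] undone, so the two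
   are inverse. *)
pose B : 'M[K]_N := \matrix_(l, j) (- gam j * (lagr j)`_(r - l)).
pose B' : 'M[K]_N := \matrix_(j, l) (- (gam j)^-1 * node j ^+ (r - l)).
have B'B : B' *m B = 1%:M.
  apply/matrixP => i j; rewrite !mxE.
  transitivity ((gam i)^-1 * gam j * (lagr j).[node i]).
    rewrite (horner_coef_wide _ (size_lagr j)) mulr_sumr [RHS](reindex_inj rev_ord_inj) /=.
    by apply: eq_bigr => l _; rewrite !mxE /= /N subSS; ring.
  rewrite lagr_node; case: eqP => [->|_]; last by rewrite mulr0.
  by rewrite mulVf ?mulr1 // gam_neq0.
have BB' := mulmx1C B'B.
pose al (l : 'I_N) : {mpoly K[N]} := (Q`_(r - l))%:MP + \sum_j (B l j) *: 'X_j.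
have coefsE l : coefs l = mmap C param (al l).
  rewrite /coefs /f /deformed coefD coef_map /= coefZ /al mmapD mmapC; congr (_ + _).
  rewrite /perturb coef_sum mulr_sumr rmorph_sum /=; apply: eq_bigr => j _.
  rewrite coefZ coef_map mmapZ mmapX mmap1U mxE rmorphM rmorphN /= /param; ring.
have -> : mmap (C \o emb) coefs p = mmap C param (mmap (@mpolyC N K \o emb) al p).
  by rewrite rmorph_mmap; apply: eq_mmap => c /=; rewrite ?mmapC ?coefsE.
move/param_indep => h.
pose be (j : 'I_N) : {mpoly K[N]} := \sum_l B' j l *: ('X_l - (Q`_(r - l))%:MP).
have ab l : mmap (@mpolyC N K) be (al l) = 'X_l.
  rewrite /al mmapD mmapC rmorph_sum /=.
  under eq_bigr => j _ do rewrite mmapZ mmapX mmap1U mul_mpolyC /be scaler_sumr.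
  rewrite exchange_big /=.
  transitivity ((Q`_(r - l))%:MP + \sum_l' (B *m B') l l' *: ('X_l' - (Q`_(r - l'))%:MP)).
    congr (_ + _); apply: eq_bigr => l' _; rewrite mxE scaler_suml.
    by apply: eq_bigr => j _; rewrite scalerA.
  rewrite BB' (bigD1 l) //= mxE eqxx scale1r big1 => [|l' ll'].
    by rewrite addr0 addrC subrK.
  by rewrite mxE eq_sym (negbTE ll') scale0r.
have : map_mpoly emb p = 0.
  rewrite -[RHS](rmorph0 (mmap (@mpolyC N K) be)) -h /= rmorph_mmap.
  rewrite /map_mpoly; apply: eq_mmap => c /=; first by rewrite mmapC.
  by rewrite ab.
move=> h'; apply/mpolyP => m; have := congr1 (mcoeff m) h'.
rewrite mcoeff_map_mpoly !mcoeff0 => /eqP.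
by rewrite fmorph_eq0 => /eqP.
Qed.

Variable G : 'I_r -> {poly K}.
Let wid (i : 'I_r) : 'I_r.+1 := lift ord_max i.
Hypothesis two_neq0 : 2%:R != 0 :> K.
Hypothesis QG : forall i, Q = ('X - (node (wid i))%:P) ^+ 2 * G i.
Hypothesis Ggam : forall i, (G i).[node (wid i)] = gam (wid i).

(* In the coordinate [x = c_i + T s_i (1 + Y)] the equation [f(x) = 0] becomes,
   after division by [T^2 s_i^2], a simple root problem for [Y] at the origin. *)
Lemma deformed_contraction i : exists psi : {poly S},
  [/\ mps_cst psi`_0 = 0, mps_cst psi`_1 = 0 & forall Y,
     (root f (C (node (wid i)) + T * s (wid i) * (1 + Y)) <-> psi.[Y] = Y)].
Proof.
set w := wid i; set c := node w.
have [q pertE] : exists q, perturb = q * ('X - (C c)%:P) + (- C (gam w) * s w ^+ 2)%:P.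
  have /factor_theorem [q qE] : root (perturb - (- C (gam w) * s w ^+ 2)%:P) (C c).
    by rewrite /root hornerD hornerN hornerC perturb_node subrr.
  by exists q; rewrite -qE subrK.
pose T' : S := \prod_(j | j != w) s j ^+ 2.
have TE : T = s w ^+ 2 * T' by rewrite /T /scale (bigD1 w).
pose lin : {poly S} := (C c)%:P + (T * s w)%:P * (1 + 'X).
pose Phi := (1 + 'X) ^+ 2 * (map_poly C (G i) \Po lin) - (C (gam w))%:P
   + (T' * s w)%:P * (1 + 'X) * (q \Po lin).
have linE Y : lin.[Y] = C c + T * s w * (1 + Y) by rewrite /lin !hornerE.
have fE Y : f.[C c + T * s w * (1 + Y)] = T ^+ 2 * s w ^+ 2 * Phi.[Y].
  rewrite /f /deformed hornerD hornerZ pertE (QG i) rmorphM rmorphXn rmorphB /=.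
  rewrite map_polyX map_polyC /= -/w -/c /Phi.
  rewrite !(hornerD, hornerM, hornerN, hornerC, hornerX, hornerXn).
  rewrite !(horner_comp, horner_exp, hornerD, hornerM, hornerN, hornerC, hornerX).
  move: (_.[_]) (q.[_]) => u v; rewrite TE; ring.
pose g2 := (2%:R * gam w)^-1.
have g2E : g2 * (2%:R * gam w) = 1 by rewrite mulVf // mulf_neq0 // gam_neq0.
(* With all [s j] set to 0, [Phi] becomes [gam w * (2 Y + Y^2)]. Dividing by the slope [2 * gam w]
   gives a Newton map whose constant and linear coefficients vanish at the origin. *)
pose psi := 'X - (C g2)%:P * Phi.
have cstC p : map_poly (@mps_cst K N) (map_poly C p) = p.
  by apply/polyP => l; rewrite !coef_map /= mps_cstC.
have cstPhi : map_poly (@mps_cst K N) Phi = (gam w)%:P * (2%:R *: 'X + 'X^2).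
  have cT : mps_cst (T * s w) = 0 by rewrite rmorphM /= cst_s mulr0.
  have clin : map_poly (@mps_cst K N) lin = c%:P.
    rewrite /lin rmorphD rmorphM /= !map_polyC /=.
    by rewrite [mps_cst (T * _)]cT [mps_cst (C c)]mps_cstC mul0r addr0.
  rewrite /Phi rmorphD rmorphB !rmorphM /= !map_comp_poly clin cstC.
  rewrite comp_polyCr Ggam !map_polyC /=.
  rewrite [mps_cst (C _)]mps_cstC rmorphD /= rmorph1 map_polyX -/w.
  by rewrite cst_s polyC0 mulr0 !mul0r -mul_polyC polyCMn polyC1; ring.
have cstpsi l : mps_cst psi`_l = ('X - g2%:P * ((gam w)%:P * (2%:R *: 'X + 'X^2)))`_l.
  rewrite -coef_map /psi rmorphB rmorphM /= map_polyX map_polyC /= cstPhi.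
  by rewrite mps_cstC.
exists psi; split.
- by rewrite cstpsi !(coefB, coefCM, coefD, coefZ, coefX, coefXn) /= mulr0 addr0 !mulr0 subrr.
- rewrite cstpsi !(coefB, coefCM, coefD, coefZ, coefX, coefXn) /= mulr1 addr0.
  by rewrite [gam w * _]mulrC g2E subrr.
have nz : T ^+ 2 * s w ^+ 2 != 0.
  by rewrite mulf_neq0 // expf_neq0 ?s_neq0 ?scale_neq0.
move=> Y; rewrite /root fE mulf_eq0 (negbTE nz) /=.
have -> : psi.[Y] = Y - C g2 * Phi.[Y].
  by rewrite /psi hornerD hornerN hornerM hornerX hornerC.
split=> [/eqP ->|/eqP].
  by rewrite mulr0 subr0.
rewrite -subr_eq0 addrAC subrr add0r oppr_eq0 mulf_eq0 => /orP [|//].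
rewrite fmorph_eq0 => /eqP g20; move/eqP: g2E.
by rewrite g20 mul0r eq_sym oner_eq0.
Qed.

(** The other reflections carry the fixed point [Y i] to a fixed point of the same [psi], so by
    uniqueness they fix the root. The own reflection changes it by [T * s_i] times a series with
    constant term 2, up to sign. *)
Lemma deformed_roots : exists x : 'I_r -> S,
  [/\ forall i, root f (x i), forall i j, j != i -> mps_sign (wid j) (x i) = x i
    & forall i, mps_sign (wid i) (x i) != x i].
Proof.
have [psi hpsi] := fin_all_exists deformed_contraction.
have [Y hY] := fin_all_exists (fun i =>
  let: And3 h0 h1 _ := hpsi i in mps_fixpoint_exists h0 h1).
exists (fun i => C (node (wid i)) + T * s (wid i) * (1 + Y i)).
have signx i j : mps_sign j (C (node (wid i)) + T * s (wid i) * (1 + Y i)) =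
    C (node (wid i)) + T * ((-1) ^+ (wid i == j) * s (wid i)) * (1 + mps_sign j (Y i)).
  by rewrite !(rmorphD, rmorphM) /= rmorph1 mps_signC sign_scale sign_s.
have rootx i : root f (C (node (wid i)) + T * s (wid i) * (1 + Y i)).
  by have [_ _ ->] := hpsi i; have [] := hY i.
split=> // [i j ji|i].
  have [h0 h1 hroot] := hpsi i; have [Y0 YE] := hY i.
  rewrite signx (inj_eq lift_inj) eq_sym (negbTE ji) mul1r.
  congr (_ + _ * (1 + _)).
  apply: (mps_fixpoint_unique h1); rewrite ?mps_cst_sign //.
  apply/hroot; have := rootx i; rewrite /root => /eqP h.
  have := congr1 (mps_sign (wid j)) h; rewrite rmorph0 -horner_map /= sign_deformed.
  by rewrite signx (inj_eq lift_inj) eq_sym (negbTE ji) mul1r => ->.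
rewrite signx eqxx mulN1r; apply/eqP => /addrI.
have [Y0 _] := hY i.
rewrite mulrN mulNr => /eqP; rewrite eq_sym -subr_eq0 opprK -mulrDr mulf_eq0.
rewrite mulf_eq0 (negbTE scale_neq0) (negbTE (s_neq0 _)) /= => /eqP.
move=> /(congr1 (@mps_cst K N)); rewrite !rmorphD /= rmorph1 rmorph0 mps_cst_sign Y0.
by rewrite !addr0 => /eqP; rewrite (negbTE two_neq0).
Qed.

Hypothesis lt_rn : (r < n)%N.
Hypothesis Qmonic : Q \is monic.
Hypothesis sizeQ : size Q = n.+1.
Hypothesis Qgap : forall j, (r < j < n)%N -> Q`_j = 0.

Lemma deformedE : f = 'X^n + \sum_(l < N) (coefs l)%:P * 'X^(r - l).
Proof.
have -> : \sum_(l < N) (coefs l)%:P * 'X^(r - l) = \poly_(l < N) f`_l.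
  rewrite poly_def (reindex_inj rev_ord_inj) /=; apply: eq_bigr => l _.
  by rewrite /coefs mul_polyC /= subKn // -ltnS.
apply/polyP => j; rewrite [RHS]coefD coefXn coef_poly.
case: ltnP => jr; first by rewrite (ltn_eqF (leq_trans jr lt_rn)) add0r.
rewrite addr0 /f /deformed coefD coefZ [perturb`_j]nth_default ?(leq_trans size_perturb) //.
rewrite mulr0 addr0 coef_map /=; case: (ltngtP j n) => jn.
- by rewrite Qgap ?rmorph0 // jr.
- by rewrite nth_default ?rmorph0 // sizeQ.
by move: Qmonic; rewrite monicE lead_coefE sizeQ /= -jn => /eqP ->; rewrite rmorph1.
Qed.

End Deformation.

Lemma exists_reflected_roots (k : fieldType) (m r : nat) :
  [pchar k] =i pred0 -> (0 < m)%N -> (r <= m)%N ->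
  exists (K : fieldType) (emb : {rmorphism k -> K}) (a : 'I_r.+1 -> mps K r.+1)
    (x : 'I_r -> mps K r.+1),
  [/\ forall p : {mpoly k[r.+1]}, mmap (mpsC K r.+1 \o emb) a p = 0 -> p = 0,
      forall i l, mps_sign i (a l) = a l,
      forall i, root ('X^(m + r) + \sum_(l < r.+1) (a l)%:P * 'X^(r - l)) (x i),
      forall i j, j != i -> mps_sign (lift ord_max j) (x i) = x i
    & forall i, mps_sign (lift ord_max i) (x i) != x i].
Proof.
(* The first [r] roots are double and the others simple, for a total degree [m + r]. *)
move=> char0 m0 le_rm; pose w (i : 'I_m) := (i < r).+1.
have w0 i : (0 < w i)%N by [].
have sw : (\sum_i w i = m + r)%N.
  under eq_bigr => i _ do rewrite /w -add1n.
  rewrite big_split /= sum_nat_const card_ord muln1; congr (_ + _)%N.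
  transitivity (\sum_(i < m | (i < r)%N) 1)%N.
    by rewrite [RHS]big_mkcond; apply: eq_bigr => i _; case: ifP.
  by rewrite -(big_ord_widen m (fun=> 1%N) le_rm) sum1_card card_ord.
have [K [emb [c [c_inj gap]]]] := exists_sparse_weighted_prod char0 m0 w0.
rewrite /= sw addKn in gap.
have charK : forall j, (j%:R == 0 :> K) = (j == 0)%N.
  by apply/pcharf0P => p; rewrite (fmorph_pchar emb) char0.
have natK_inj : injective (fun j => j%:R : K).
  move=> i j /eqP; wlog le : i j / (i <= j)%N.
    by move=> h; case: (leqP i j) => [/h|/ltnW/h] // h'; rewrite eq_sym => /h'.
  rewrite eq_sym -subr_eq0 -natrB // charK subn_eq0 => ge.
  by apply/eqP; rewrite eqn_leq le.
(* The extra node: of the [m + 1] distinct integers [0, ..., m] in [K], one avoids the [m] values of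
   [c]. *)
have [nu nuc] : exists nu, forall i, nu != c i.
  apply: contrapT => no.
  have /fin_all_exists [g gE] (j : 'I_m.+1) : exists i, j%:R = c i.
    apply: contrapT => no'; apply: no; exists j%:R => i.
    by apply/eqP => e; apply: no'; exists i.
  have /leq_card : injective g.
    by move=> j j' e; apply/val_inj/natK_inj; rewrite /= !gE e.
  by rewrite !card_ord ltnn.
pose wm := widen_ord le_rm.
pose node (i : 'I_r.+1) := oapp (c \o wm) nu (unlift ord_max i).
pose G (i : 'I_r) := \prod_(l | l != wm i) ('X - (c l)%:P) ^+ w l.
(* At the extra node any nonzero value would do. *)
pose gam (i : 'I_r.+1) := oapp (fun j => (G j).[c (wm j)]) 1 (unlift ord_max i).
have nodeE i : node (lift ord_max i) = c (wm i) by rewrite /node liftK.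
have node_inj : injective node.
  move=> i j; rewrite /node.
  case: (unliftP ord_max i) => [i'|] ->; case: (unliftP ord_max j) => [j'|] -> //=.
  - by move/c_inj => /(congr1 val) /= e; congr lift; apply: val_inj.
  - by move/esym/eqP; rewrite (negbTE (nuc _)).
  - by move/eqP; rewrite (negbTE (nuc _)).
have gam0 j : gam j != 0.
  rewrite /gam; case: (unlift ord_max j) => [i|] /=; last exact: oner_neq0.
  rewrite /G horner_prod; apply/prodf_neq0 => l li.
  by rewrite horner_exp hornerXsubC expf_neq0 // subr_eq0 (inj_eq c_inj) eq_sym.
have QG i : weighted_prod w c = ('X - (node (lift ord_max i))%:P) ^+ 2 * G i.
  by rewrite nodeE /weighted_prod (bigD1 (wm i)) //= /w /= ltn_ord.
have Ggam i : (G i).[node (lift ord_max i)] = gam (lift ord_max i).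
  by rewrite nodeE /gam liftK.
have two0 : 2%:R != 0 :> K by rewrite charK.
have lt : (r < m + r)%N by rewrite -{1}(add0n r) ltn_add2r.
have mQ : weighted_prod w c \is monic by exact: monic_weighted_prod.
have sQ : size (weighted_prod w c) = (m + r).+1 by rewrite size_weighted_prod // sw.
have gapQ : forall j, (r < j < m + r)%N -> (weighted_prod w c)`_j = 0 by exact: gap.
have [x [xroot xfix xmove]] := deformed_roots node_inj gam0 two0 QG Ggam.
exists K, emb, (coefs (weighted_prod w c) node gam), x; split=> //.
- by move=> p; apply: coefs_indep.
- by move=> i l; apply: sign_coefs.
- by move=> i; rewrite -deformedE.
Qed.

(** * Fraction fields *)

Section FractionLift.
Variable A : idomainType.
Local Notation tf := (@FracField.tofrac A).

Lemma fracE (z : {fraction A}) : exists u v : A, v != 0 /\ z = tf u / tf v.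
Proof.
elim/quotW: z => x; exists (frac x).1, (frac x).2; split; first exact: denom_ratioP.
unlock FracField.tofrac; rewrite -[X in _ = _ * X]FracField.pi_inv.
rewrite -[RHS]FracField.pi_mul /FracField.mulf /FracField.invf.
have d0 := denom_ratioP x.
by rewrite !numden_Ratio ?oner_neq0 // mulr1 mul1r Ratio_numden.
Qed.

Variables (L : fieldType) (phi : {rmorphism A -> L}).
Hypothesis phi_inj : forall u, phi u = 0 -> u = 0.

(** Defined on a chosen numerator and denominator; [fraclift_div] shows that the choice does not
    matter. *)
Definition fraclift (z : {fraction A}) : L :=
  let u := projT1 (cid (fracE z)) in
  let v := projT1 (cid (projT2 (cid (fracE z)))) in phi u / phi v.

Let phi_neq0 u : u != 0 -> phi u != 0.
Proof. by apply: contraNN => /eqP /phi_inj ->. Qed.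

Lemma fraclift_div u v : v != 0 -> fraclift (tf u / tf v) = phi u / phi v.
Proof.
move=> v0; rewrite /fraclift; case: cid => u' h /=; case: cid => v' /= [v'0 e].
apply/eqP; rewrite eqr_div ?phi_neq0 // -!rmorphM /=.
move/eqP: e; rewrite eqr_div ?tofrac_eq0 // -!tofracM tofrac_eq => /eqP e.
by rewrite e.
Qed.

Lemma fraclift_tofrac u : fraclift (tf u) = phi u.
Proof.
have := fraclift_div u (oner_neq0 A).
by rewrite tofrac1 rmorph1 !divr1.
Qed.

Lemma fraclift_zmod : zmod_morphism fraclift.
Proof.
move=> x y; have [u [v [v0 ->]]] := fracE x; have [u' [v' [v'0 ->]]] := fracE y.
rewrite !fraclift_div // -!mulNr -tofracN addf_div ?tofrac_eq0 //.
rewrite -!tofracM -tofracD fraclift_div ?mulf_neq0 //.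
by rewrite !(rmorphD, rmorphM, rmorphN) /= [RHS]addf_div ?phi_neq0.
Qed.

Lemma fraclift_monoid : monoid_morphism fraclift.
Proof.
split=> [|x y]; first by rewrite -tofrac1 fraclift_tofrac rmorph1.
have [u [v [v0 ->]]] := fracE x; have [u' [v' [v'0 ->]]] := fracE y.
by rewrite mulf_div -!tofracM !fraclift_div ?mulf_neq0 // !rmorphM mulf_div.
Qed.

HB.instance Definition _ :=
  GRing.isZmodMorphism.Build {fraction A} L fraclift fraclift_zmod.
HB.instance Definition _ :=
  GRing.isMonoidMorphism.Build {fraction A} L fraclift fraclift_monoid.

Lemma exists_fraction_lift : exists iota : {rmorphism {fraction A} -> L},
  forall u, iota (tf u) = phi u.
Proof. by exists fraclift; exact: fraclift_tofrac. Qed.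

End FractionLift.

Lemma eq_fraction_rmorphism (A : idomainType) (L : fieldType)
    (f g : {rmorphism {fraction A} -> L}) :
  (forall u, f (FracField.tofrac u) = g (FracField.tofrac u)) -> f =1 g.
Proof. by move=> fg z; have [u [v [v0 ->]]] := fracE z; rewrite !fmorph_div !fg. Qed.

Lemma clear_denominators (A : idomainType) (P : {poly {fraction A}}) :
  exists (d : A) (Q : {poly A}),
    d != 0 /\ FracField.tofrac d *: P = map_poly (@FracField.tofrac A) Q.
Proof.
elim/poly_ind: P => [|P z [d [Q [d0 e]]]].
  by exists 1, 0; rewrite oner_neq0 scaler0 rmorph0.
have [u [v [v0 ->]]] := fracE z.
exists (d * v), (v *: Q * 'X + (d * u)%:P); split; first exact: mulf_neq0.
rewrite rmorphD /= map_polyC /= [X in _ = X + _]rmorphM /= map_polyX map_polyZ -e.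
rewrite !tofracM scalerDr -!scalerAl scalerA; congr (_ + _).
  by rewrite [X in X *: _]mulrC.
rewrite -mul_polyC -polyCM; congr (_%:P).
by rewrite -mulrA; congr (_ * _); rewrite mulrCA divff ?mulr1 ?tofrac_eq0.
Qed.

Lemma algebraic_on_algebraicOver (k L : fieldType) (emb : {rmorphism k -> L}) d
    (b : 'I_d -> L) (theta : {rmorphism {fraction {mpoly k[d]}} -> L}) x :
  (forall p, theta (FracField.tofrac p) = mmap emb b p) ->
  algebraicOver theta x -> algebraic_on emb b x.
Proof.
move=> thetaE [P P0 rP]; have [e [Q [e0 eQ]]] := clear_denominators P.
have e0' : FracField.tofrac e != 0 by rewrite tofrac_eq0.
have mapE : map_poly (mmap emb b) Q = map_poly theta (FracField.tofrac e *: P).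
  by rewrite eQ; apply/polyP => i; rewrite !coef_map /= thetaE.
exists Q.
  rewrite -thetaE fmorph_eq0 tofrac_eq0 lead_coef_eq0.
  apply: contra_neq P0 => Q0; move: eQ; rewrite Q0 rmorph0 => /eqP.
  by rewrite scaler_eq0 (negbTE e0') => /eqP.
by rewrite mapE map_polyZ rootZ ?fmorph_eq0.
Qed.

(** * Leading exponents *)

Section LeadingExponents.
Variables (K : fieldType) (N : nat).
Implicit Types (f g : mps K N) (m : 'X_{1..N}).

Lemma mps_lead_cst c : c != 0 -> mps_lead (mpsC K N c) 0%MM.
Proof.
move=> c0; split=> [|m]; first by rewrite /= /mps_of_mpoly mcoeffC eqxx mulr1.
by rewrite ltNge le0m.
Qed.

Lemma mps_lead_prod (I : Type) (s : seq I) (P : pred I) (F : I -> mps K N) E :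
  (forall i, P i -> mps_lead (F i) (E i)) ->
  mps_lead (\prod_(i <- s | P i) F i) (\sum_(i <- s | P i) E i)%MM.
Proof.
move=> h; apply: (big_ind2 (fun f m => mps_lead f m)) => //.
  by rewrite -(rmorph1 (mpsC K N)); apply/mps_lead_cst/oner_neq0.
by move=> f1 m1 f2 m2 h1 h2; have [] := mps_leadM h1 h2.
Qed.

Lemma mps_lead_exp f m a : mps_lead f m -> mps_lead (f ^+ a) (m *+ a)%MM.
Proof.
move=> h; elim: a => [|a IH].
  by rewrite mulm0n expr0 -(rmorph1 (mpsC K N)); apply/mps_lead_cst/oner_neq0.
by rewrite exprS mulmS; have [] := mps_leadM h IH.
Qed.

(** The least of the exponents [E x] is reached by one summand only, so the sum has a nonzero
    coefficient there. *)
Lemma mps_sum_distinct_lead (T : eqType) (s : seq T) (F : T -> mps K N) E :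
  uniq s -> s != [::] -> (forall x, x \in s -> mps_lead (F x) (E x)) ->
  {in s &, injective E} -> \sum_(x <- s) F x != 0.
Proof.
move=> us s0 hF Einj.
have [x0 x0s x0min] : exists2 x0, x0 \in s & forall x, x \in s -> (E x0 <= E x)%O.
  elim: {us hF Einj} s s0 => // x [|y s] IH _.
    by exists x; rewrite ?inE // => z; rewrite inE => /eqP ->.
  have [x0 h0 hmin] := IH isT.
  have [le|lt] := leP (E x0) (E x).
    exists x0; first by rewrite inE h0 orbT.
    by move=> z; rewrite inE => /orP [/eqP ->|/hmin].
  exists x; first by rewrite inE eqxx.
  move=> z; rewrite inE => /orP [/eqP -> //|/hmin]; exact/le_trans/ltW.
apply/eqP => /(congr1 (fun f : mps K N => f (E x0))); rewrite mps0 mps_sum.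
rewrite (bigD1_seq x0) //= big_seq_cond big1 ?addr0 => [/eqP|x /andP [xs xx0]].
  by have [/negbTE ->] := hF _ x0s.
have [_ ->] := hF _ xs => //; rewrite lt_neqAle x0min // andbT.
by apply: contra xx0 => /eqP e; apply/eqP/Einj.
Qed.

(** The equation says, without denominators, that the reflection multiplies [f / g] by [(-1) ^+ b].
    It multiplies the coefficient at [m] by [(-1) ^+ m i], so comparing lowest terms gives the
    parity. *)
Lemma mps_sign_parity (i : 'I_N) f g (b : bool) m m' : 2%:R != 0 :> K ->
  mps_lead f m -> mps_lead g m' ->
  mps_sign i f * g = (-1) ^+ b * (f * mps_sign i g) ->
  odd (m i + m' i) = b.
Proof.
move=> two0 fm gm e; have [f0 _] := fm; have [g0 _] := gm.
have [_ e1] := mps_leadM (mps_sign_lead i fm) gm.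
have [_ e2] := mps_leadM fm (mps_sign_lead i gm).
have := congr1 (fun u : mps K N => u (m + m')%MM) e; rewrite e1.
have -> : ((-1) ^+ b * (f * mps_sign i g)) (m + m')%MM
    = (-1) ^+ b * (f * mps_sign i g) (m + m')%MM.
  by case: (b); rewrite ?mulN1r ?expr0 ?mul1r.
rewrite e2 /mps_sign => h.
have {h} : (-1) ^+ m i = (-1) ^+ b * (-1) ^+ m' i :> K.
  by apply: (mulIf (mulf_neq0 f0 g0)); rewrite mulrA h; ring.
rewrite -exprD -signr_odd -[RHS]signr_odd oddD oddb => h.
have : odd (m i) = b (+) odd (m' i).
  have neq1 : (1 == -1 :> K) = false.
    by rewrite -subr_eq0 opprK -(natrD _ 1 1) (negbTE two0).
  move: h; case: (odd (m i)); case: (b (+) odd (m' i)) => //= /eqP.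
    by rewrite eq_sym expr0 expr1 neq1.
  by rewrite expr0 expr1 neq1.
by rewrite oddD => ->; rewrite -addbA addbb addbF.
Qed.

End LeadingExponents.

(** Modulo 2 the matrix [W] is the identity, so its determinant is nonzero. *)
Lemma int_matrix_odd_unit r (W : 'M[int]_r) (u : 'rV[int]_r) :
  (forall i j, odd `|W i j|%N = (i == j)) -> u *m W = 0 -> u = 0.
Proof.
move=> Wodd uW.
have natF2 a : a%:R = (odd a)%:R :> 'F_2.
  rewrite -{1}(odd_double_half a) natrD -mul2n natrM.
  by rewrite (_ : 2%:R = 0 :> 'F_2) ?mul0r ?addr0 //; apply: val_inj.
have W1 : map_mx (intr : int -> 'F_2) W = 1%:M.
  apply/matrixP => i j; rewrite !mxE -(Wodd i j) -natF2.
  case: (W i j) => a //; rewrite NegzE mulrNz abszN.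
  by rewrite oppr_pchar2 //; apply: pchar_Fp.
have dW : \det W != 0.
  apply/eqP => d0; have := det_map_mx (intr : {rmorphism int -> 'F_2}) W.
  by rewrite W1 det1 d0 rmorph0 => /eqP; rewrite oner_eq0.
have : u *m W *m \adj W = \det W *: u by rewrite -mulmxA mul_mx_adj mul_mx_scalar.
rewrite uW mul0mx => /esym/eqP.
by rewrite scalemx_eq0 (negbTE dW) => /eqP.
Qed.

(** * Algebraic independence from reflection parities *)

Section ReflectionIndependence.
Variables (k K : fieldType) (emb : {rmorphism k -> K}) (r : nat).
Let S := mps K r.+1.
Local Notation tf := (@FracField.tofrac S).
Variables (u v : 'I_r -> S).
Hypothesis two_neq0 : 2%:R != 0 :> K.
Hypothesis u_neq0 : forall i, u i != 0.
Hypothesis v_neq0 : forall i, v i != 0.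
Hypothesis sign_uv : forall i j, mps_sign (lift ord_max j) (u i) * v i =
  (-1) ^+ (i == j) * (u i * mps_sign (lift ord_max j) (v i)).

(* The leading exponents of the quotients [u i / v i] form the identity matrix
   modulo 2, so distinct monomials in these quotients have distinct leading
   exponents. *)
Lemma reflected_indep : indep (tf \o (mpsC K r.+1 \o emb) : {rmorphism k -> _})
  (fun i => tf (u i) / tf (v i)).
Proof.
move=> p p0; apply/eqP; apply: contraT => pn0; exfalso.
have [mu hmu] := fin_all_exists (fun i => mps_lead_exists (u_neq0 i)).
have [nu hnu] := fin_all_exists (fun i => mps_lead_exists (v_neq0 i)).
(* [M] bounds all exponents in [p], so multiplying the relation by the product of the [v i ^+ M]
   clears denominators; [F q] is the resulting term for [q], with leading exponent [E q]. *)
pose M := msize p.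
pose F (q : 'X_{1..r}) : S := mpsC K r.+1 (emb p@_q) *
  \prod_i (u i ^+ q i * v i ^+ (M - q i)).
pose E (q : 'X_{1..r}) : 'X_{1..r.+1} :=
  (0 + \sum_i (mu i *+ q i + nu i *+ (M - q i)))%MM.
have qM q : q \in msupp p -> forall i, (q i <= M)%N.
  move=> /msize_mdeg_lt /ltnW h i; apply: leq_trans h.
  by rewrite mdegE (bigD1 i) //= leq_addr.
have hF q : q \in msupp p -> mps_lead (F q) (E q).
  rewrite mcoeff_msupp => q0.
  have h1 : mps_lead (mpsC K r.+1 (emb p@_q)) 0%MM.
    by apply: mps_lead_cst; rewrite fmorph_eq0.
  have h2 : mps_lead (\prod_i (u i ^+ q i * v i ^+ (M - q i)))
      (\sum_i (mu i *+ q i + nu i *+ (M - q i)))%MM.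
    apply: mps_lead_prod => i _.
    have := mps_leadM (mps_lead_exp (q i) (hmu i)) (mps_lead_exp (M - q i) (hnu i)).
    by case.
  by have [] := mps_leadM h1 h2.
have Einj : {in msupp p &, injective E}.
  move=> q q' hq hq' e.
  (* The exponents of [u i / v i] in the first [r] variables; the last variable is left out because
     no parity is known for it. *)
  pose W : 'M[int]_r :=
    \matrix_(i, j) ((mu i (lift ord_max j))%:Z - (nu i (lift ord_max j))%:Z).
  pose ka : 'rV[int]_r := \row_i ((q i)%:Z - (q' i)%:Z).
  have : ka = 0.
    apply: (@int_matrix_odd_unit _ W).
      move=> i j; rewrite mxE.
      rewrite -(mps_sign_parity two_neq0 (hmu i) (hnu i) (sign_uv i j)); lia.
    apply/rowP => j; rewrite !mxE.
    have sumE (t : 'X_{1..r}) : t \in msupp p -> (E t (lift ord_max j))%:R =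
        \sum_i ((mu i (lift ord_max j))%:R * (t i)%:R
                + (nu i (lift ord_max j))%:R * (M%:R - (t i)%:R)) :> int.
      move=> ht; rewrite /E mnmDE mnm0E add0n mnm_sumE natr_sum.
      by apply: eq_bigr => i _; rewrite mnmDE !mulmnE natrD !natrM natrB ?qM.
    transitivity ((E q (lift ord_max j))%:R - (E q' (lift ord_max j))%:R : int).
      rewrite !sumE // -sumrB; apply: eq_bigr => i _.
      by rewrite !mxE -!natz; ring.
    by rewrite e subrr.
  move=> /rowP ka0; apply/mnmP => i; have := ka0 i.
  by rewrite !mxE => /eqP; rewrite subr_eq0 => /eqP [].
have : \sum_(q <- msupp p) F q != 0.
  by apply: mps_sum_distinct_lead hF Einj; rewrite ?msupp_uniq ?msupp_eq0.
move/eqP; apply; apply/eqP; rewrite -tofrac_eq0; apply/eqP.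
rewrite -[RHS](mulr0 (tf (\prod_i v i ^+ M))) -p0 rmorph_sum mulr_sumr /=.
rewrite big_seq [RHS]big_seq; apply: eq_bigr => q hq.
rewrite /F rmorphM mulrCA; congr (_ * _).
rewrite /mmap1 !rmorph_prod -big_split /=; apply: eq_bigr => i _.
rewrite rmorphM !rmorphXn /= expr_div_n -{2}(subnK (qM _ hq i)) exprD.
have vi : tf (v i) ^+ q i != 0 by rewrite expf_neq0 // tofrac_eq0.
by rewrite mulrC -[RHS]mulrA; congr (_ * _); rewrite mulrCA divff ?mulr1.
Qed.

End ReflectionIndependence.

(** * Transcendence degree *)

Section TranscendenceDegree.
Variables (k F : fieldType) (emb : {rmorphism k -> F}).
Implicit Types (s l : seq F).

Lemma alg_indepP s :
  alg_indep emb s <-> indep emb (fun i : 'I_(size s) => s`_i).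
Proof.
have e p : (map_mpoly emb p).@[fun i : 'I_(size s) => s`_i] =
    mmap emb (fun i : 'I_(size s) => s`_i) p.
  rewrite /map_mpoly rmorph_mmap; apply: eq_mmap => i /=; first by rewrite mevalC.
  by rewrite mevalXU.
by split=> h p; [rewrite -e | rewrite e]; exact: h.
Qed.

(** Renaming variables along an injection has the left inverse [down], so a relation that becomes
    zero was zero. *)
Lemma indep_comp n n' (f : 'I_n -> 'I_n') (y : 'I_n' -> F) :
  injective f -> indep emb y -> indep emb (y \o f).
Proof.
move=> finj iy p p0.
pose up := mmap (@mpolyC n' k) (fun i => 'X_(f i)) p.
pose down (j : 'I_n') : {mpoly k[n]} :=
  if [pick i | f i == j] is Some i then 'X_i else 0.
have up0 : up = 0.
  apply: iy; rewrite /up rmorph_mmap -[RHS]p0.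
  by apply: eq_mmap => i /=; rewrite ?mmapC ?mmapX ?mmap1U.
have : mmap (@mpolyC n k) down up = 0 by rewrite up0 rmorph0.
rewrite /up rmorph_mmap => <-; rewrite {1}[p]mpolyE.
apply: eq_bigr => mu _; rewrite /= mmapC mul_mpolyC; congr (_ *: _).
rewrite mpolyXE_id; apply: eq_bigr => i _ /=; rewrite mmapX mmap1U /down.
case: pickP => [j /eqP /finj -> //|/(_ i)]; by rewrite eqxx.
Qed.

Lemma alg_indep_uniq s : alg_indep emb s -> uniq s.
Proof.
move=> /alg_indepP is_s; apply/(uniqP 0) => i j /= hi hj e.
apply/eqP; apply: contraT => ij.
have := is_s ('X_(Ordinal hi) - 'X_(Ordinal hj)).
rewrite rmorphB /= !mmapX !mmap1U /= e subrr => /(_ erefl) /eqP.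
rewrite subr_eq0 => /eqP /(congr1 (mcoeff U_(Ordinal hi))).
rewrite !mcoeffXU eqxx; case: eqP => [/(congr1 val) /= e'|_ /eqP].
  by rewrite e' eqxx in ij.
by rewrite oner_eq0.
Qed.

Lemma alg_indep_notin0 s : alg_indep emb s -> 0 \notin s.
Proof.
move=> /alg_indepP is_s; apply/negP => /(nthP 0) [i hi e].
have /(congr1 (mcoeff U_(Ordinal hi))) /eqP : 'X_(Ordinal hi) = 0 :> {mpoly k[_]}.
  by apply: is_s; rewrite mmapX mmap1U.
by rewrite mcoeffXU eqxx mcoeff0 oner_eq0.
Qed.

Lemma alg_indep_sub s s' : alg_indep emb s -> uniq s' -> {subset s' <= s} ->
  alg_indep emb s'.
Proof.
move=> /alg_indepP is_s us' sub; apply/alg_indepP.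
have lt (i : 'I_(size s')) : (index (s'`_i)%R s < size s)%N.
  by rewrite index_mem sub // mem_nth.
pose f i := Ordinal (lt i).
have finj : injective f.
  move=> i j /(congr1 val) /= e; apply: val_inj => /=.
  apply/eqP; rewrite -(nth_uniq 0 (ltn_ord i) (ltn_ord j) us'); apply/eqP.
  rewrite -(nth_index 0 (sub _ (mem_nth 0 (ltn_ord i)))) e.
  by rewrite nth_index // sub // mem_nth.
move=> p p0; apply: (indep_comp finj is_s); rewrite -[RHS]p0.
by apply: eq_mmap => // i /=; rewrite nth_index // sub // mem_nth.
Qed.

Lemma alg_indep_nil : alg_indep emb [::].
Proof.
apply/alg_indepP => p; rewrite /= (nvar0_mpolyC p) mmapC => /eqP.
by rewrite fmorph_eq0 => /eqP ->; rewrite mpolyC0.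
Qed.

Lemma leq_trdeg s l : subseq s l -> alg_indep emb s -> (size s <= trdeg emb l)%N.
Proof.
case/subseqP => m sm -> im.
have sm' : size m == size l by rewrite sm.
have := @leq_bigmax_cond _ (fun b : (size l).-tuple bool => `[< alg_indep emb (mask b l) >])
  (fun b => size (mask b l)) (Tuple sm').
by apply; apply/asboolP.
Qed.

Lemma trdeg_attained l : exists s,
  [/\ subseq s l, alg_indep emb s & size s = trdeg emb l].
Proof.
pose P (b : (size l).-tuple bool) := `[< alg_indep emb (mask b l) >].
have P0 : P [tuple of nseq (size l) false].
  by apply/asboolP; rewrite /= mask_false; exact: alg_indep_nil.
have c0 : (0 < #|P|)%N by apply/card_gt0P; exists [tuple of nseq (size l) false].
have [b /asboolP ib eb] := eq_bigmax_cond (fun b : (size l).-tuple bool => size (mask b l)) c0.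
by exists (mask b l); split; rewrite ?mask_subseq.
Qed.

(** A relation among [x :: s] is a polynomial in [x] over [k[s]]: if nonzero it makes [x] algebraic,
    otherwise the relation is trivial. *)
Lemma alg_indep_cons s (theta : {rmorphism {fraction {mpoly k[size s]}} -> F}) x :
  (forall p, theta (FracField.tofrac p) =
             mmap emb (fun i : 'I_(size s) => s`_i) p) ->
  ~ algebraicOver theta x -> alg_indep emb (x :: s).
Proof.
move=> thetaE nalg; apply/alg_indepP => p p0; pose d := size s.
pose X (i : 'I_d.+1) : {poly {mpoly k[d]}} :=
  oapp (fun j => ('X_j)%:P) 'X (unlift ord0 i).
pose P := mmap (polyC \o @mpolyC d k) X p.
have XE (R : comNzRingType) (h : {rmorphism {mpoly k[d]} -> R}) (y : R) i :
    (map_poly h (X i)).[y] = oapp (fun j => h 'X_j) y (unlift ord0 i).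
  by rewrite /X; case: unlift => [j|] /=; rewrite ?map_polyC ?map_polyX ?hornerC ?hornerX.
have PE (R : comNzRingType) (h : {rmorphism {mpoly k[d]} -> R}) (y : R) :
    (map_poly h P).[y] = mmap (h \o @mpolyC d k) (fun i => (map_poly h (X i)).[y]) p.
  rewrite /P rmorph_mmap -/(horner_eval y _) rmorph_mmap.
  apply: eq_mmap => i //=.
  by rewrite map_polyC /= /horner_eval hornerC.
have [P0|Pn0] := eqVneq P 0.
  have : (map_poly (mmap (@mpolyC d.+1 k) (fun j => 'X_(lift ord0 j))) P).['X_ord0] = 0.
    by rewrite P0 rmorph0 horner0.
  rewrite PE => <-; rewrite {1}[p]mpolyE.
  apply: eq_bigr => mu _; rewrite /= mmapC mul_mpolyC; congr (_ *: _).
  rewrite mpolyXE_id; apply: eq_bigr => i _ /=; rewrite XE.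
  by case: unliftP => [j|] -> //=; rewrite mmapX mmap1U.
case: nalg; exists (map_poly (@FracField.tofrac _) P).
  rewrite map_poly_eq0_id0 // tofrac_eq0 lead_coef_eq0 //.
rewrite -map_poly_comp /root.
rewrite (_ : map_poly _ P = map_poly (mmap emb (fun i : 'I_d => s`_i)) P); last first.
  by apply/polyP => i; rewrite !coef_map_id0 ?rmorph0 //= thetaE.
rewrite PE; apply/eqP; rewrite -[RHS]p0; apply: eq_mmap => [c|i] /=.
  by rewrite mmapC.
by rewrite XE; case: unliftP => [j|] -> //=; rewrite mmapX mmap1U.
Qed.

(** A largest independent subfamily is a transcendence basis: an entry transcendental over it would
    enlarge it. *)
Lemma trdeg_basis l : exists (s : seq F)
    (theta : {rmorphism {fraction {mpoly k[size s]}} -> F}),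
  [/\ size s = trdeg emb l,
      forall p, theta (FracField.tofrac p) =
                mmap emb (fun i : 'I_(size s) => s`_i) p
    & forall x, x \in l -> algebraicOver theta x].
Proof.
have [s [sl is_s es]] := trdeg_attained l.
have /alg_indepP is_s' := is_s.
have [theta thetaE] := @exists_fraction_lift _ _
  (mmap emb (fun i : 'I_(size s) => s`_i) : {rmorphism _ -> F}) is_s'.
exists s, theta; split=> // x xl; apply: contrapT => nalg.
have ixs := alg_indep_cons thetaE nalg.
(* [trdeg] sees only subsequences of [l], so the enlarged family is put in the order of [l]. *)
pose s2 := [seq y <- undup l | y \in x :: s].
have us2 : uniq s2 by rewrite filter_uniq // undup_uniq.
have s2E : s2 =i x :: s.
  move=> y; rewrite mem_filter mem_undup andb_idr // inE => /orP [/eqP -> //|].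
  exact: (mem_subseq sl).
have is2 : alg_indep emb s2 by apply: alg_indep_sub ixs us2 _ => y; rewrite s2E.
have sub : subseq s2 l := subseq_trans (filter_subseq _ _) (undup_subseq l).
have := leq_trdeg sub is2.
by rewrite (perm_size (uniq_perm us2 (alg_indep_uniq ixs) s2E)) /= es ltnn.
Qed.

(** Roots of [p] are integral over the field generated by a transcendence basis of its coefficients,
    so their differences are algebraic over it, and [r] independent ones need at least [r] basis
    elements. *)
Lemma leq_trdeg_lower_coefs (L : fieldType) (iota : {rmorphism F -> L}) r
    (z z' : 'I_r -> L) (p : {poly F}) :
  p \is monic -> (forall i, root (map_poly iota p) (z i)) ->
  (forall i, root (map_poly iota p) (z' i)) ->
  indep (iota \o emb) (fun i => z i - z' i) ->
  (r <= trdeg emb (lower_coefs p))%N.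
Proof.
move=> pmon rz rz' iz.
have [s [theta [<- thetaE algl]]] := trdeg_basis (lower_coefs p).
pose theta' : {rmorphism {fraction {mpoly k[size s]}} -> L} := iota \o theta.
have thetaE' q : theta' (FracField.tofrac q) =
    mmap (iota \o emb) (fun i : 'I_(size s) => iota s`_i) q.
  by rewrite /= thetaE rmorph_mmap.
have algp : {in map_poly iota p : seq L, integralRange theta'}.
  apply/integral_poly => i; rewrite coef_map /=.
  have [lt|] := ltnP i (size p).-1.
    apply: integral_rmorph; apply/integral_algebraic/algl.
    by apply: map_f; rewrite mem_iota.
  rewrite leq_eqVlt => /orP [/eqP <-|lt].
    by rewrite -lead_coefE (monicP pmon) rmorph1; exact: integral1.
  rewrite nth_default ?rmorph0; first exact: integral0.
  by move: lt; case: (size p).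
have pn0 : map_poly iota p != 0 by rewrite map_poly_eq0 monic_neq0.
have alg i : algebraicOver theta' (z i - z' i).
  apply: algebraic_sub; apply/integral_algebraic; apply: integral_root pn0 _ algp.
    exact: rz.
  exact: rz'.
apply: indep_algebraic_on_leq iz _ => i.
exact: algebraic_on_algebraicOver thetaE' (alg i).
Qed.

End TranscendenceDegree.

(** * Generators of the quotient algebra *)

Section QuotientAlgebra.
Variables (F : fieldType) (f : {poly F}).
Hypothesis f_monic : f \is monic.
Hypothesis size_f : (1 < size f)%N.

Lemma mk_monic_id : mk_monic f = f.
Proof. by rewrite /mk_monic size_f f_monic. Qed.

Lemma in_qpoly_val (e : {poly %/ f}) : in_qpoly f (val e) = e.
Proof. by apply: val_inj; rewrite /= Pdiv.CommonRing.rmodp_small ?size_mk_monic. Qed.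

Lemma horner_alg_in_qpoly (u q : {poly F}) :
  horner_alg (in_qpoly f u) q = in_qpoly f (q \Po u).
Proof.
elim/poly_ind: q => [|q a IH]; first by rewrite comp_poly0 !rmorph0.
rewrite comp_polyD comp_polyM comp_polyX comp_polyC !rmorphD !rmorphM /= IH.
rewrite horner_algX horner_algC; congr (_ + _).
by rewrite -alg_polyC linearZ /= rmorph1.
Qed.

Lemma in_qpoly_eq0 (q : {poly F}) : (in_qpoly f q == 0) = (f %| q)%R.
Proof.
have -> : (f %| q)%R = (q %% f == 0) by [].
by rewrite -(inj_eq val_inj) /= mk_monic_id Pdiv.IdomainMonic.modpE.
Qed.

Lemma horner_in_qpoly (L : fieldType) (iota : {rmorphism F -> L}) x q :
  root (map_poly iota f) x ->
  (map_poly iota (val (in_qpoly f q))).[x] = (map_poly iota q).[x].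
Proof.
move=> /eqP fx; rewrite /= mk_monic_id -Pdiv.IdomainMonic.modpE //.
rewrite [in RHS](divp_eq q f) rmorphD rmorphM /= hornerD hornerM fx.
by rewrite mulr0 add0r.
Qed.

End QuotientAlgebra.

Lemma comp_scale_id (F : fieldType) (c : F) (q : {poly F}) : c != 0 ->
  (q \Po (c *: 'X)) \Po (c^-1 *: 'X) = q.
Proof.
move=> c0; rewrite -comp_polyA comp_polyZ comp_polyX scalerA mulfV //.
by rewrite scale1r comp_polyXr.
Qed.


(** * Upper bound by rescaling the generator *)

Section ScaledGenerator.
Variables (k F : fieldType) (emb : {rmorphism k -> F}) (f : {poly F}) (n r : nat).
Hypothesis f_monic : f \is monic.
Hypothesis size_f : size f = n.+1.
Hypothesis r_gt0 : (0 < r)%N.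
Hypothesis lt_rn : (r < n)%N.
Hypothesis f0_neq0 : f`_0 != 0.
Hypothesis f1_neq0 : f`_1 != 0.
Hypothesis f_gap : forall j, (r < j < n)%N -> f`_j = 0.

Lemma generator_leq_trdeg : exists (z : {poly %/ f}) (p : {poly F}),
  [/\ generates z, is_minpoly z p & (trdeg emb (lower_coefs p) <= r)%N].
Proof.
(* The two lowest coefficients of [p] below are [c ^- n * f_0] and [c ^- n * c * f_1]; this [c]
   makes them equal. *)
pose c := f`_0 / f`_1; have c0 : c != 0 by rewrite mulf_neq0 ?invr_eq0.
have fs : (1 < size f)%N by rewrite size_f ltnS (leq_ltn_trans _ lt_rn).
pose p : {poly F} := (c ^- n) *: (f \Po (c *: 'X)).
have pE j : p`_j = c ^- n * c ^+ j * f`_j.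
  rewrite /p coefZ -mulrA; congr (_ * _).
  rewrite comp_polyE coef_sum.
  under eq_bigr => i _ do rewrite exprZn scalerA coefZ coefXn.
  have [lt|ge] := ltnP j (size f).
    rewrite (bigD1 (Ordinal lt)) //= eqxx mulr1 big1 ?addr0 1?mulrC // => i.
    by rewrite -val_eqE eq_sym /= => /negbTE ->; rewrite mulr0.
  rewrite nth_default // mulr0 big1 // => i _.
  by rewrite gtn_eqF ?mulr0 // (leq_trans (ltn_ord i)).
have sp : size p = n.+1.
  rewrite size_scale ?invr_eq0 ?expf_neq0 // size_comp_poly2 ?size_f //.
  by rewrite size_scale // size_polyX.
have pm : p \is monic.
  rewrite monicE lead_coefE sp pE mulVf ?mul1r ?expf_neq0 //.
  by move: f_monic; rewrite monicE lead_coefE size_f.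
have pf : p \Po (c^-1 *: 'X) = c ^- n *: f by rewrite comp_polyZ comp_scale_id.
exists (in_qpoly f (c^-1 *: 'X)), p; split.
- move=> e; exists (val e \Po (c *: 'X)).
  by rewrite horner_alg_in_qpoly comp_scale_id // in_qpoly_val.
- split=> //.
    apply/eqP; rewrite horner_alg_in_qpoly in_qpoly_eq0 // pf.
    by rewrite -mul_polyC dvdp_mull.
  move=> q /eqP; rewrite horner_alg_in_qpoly in_qpoly_eq0 // => fq.
  have := dvdp_comp_poly (c *: 'X) fq.
  have := comp_scale_id q (invr_neq0 c0); rewrite invrK => -> h.
  by apply: dvdp_trans h; rewrite /p dvdpZl ?invr_eq0 ?expf_neq0.
have [s [sl is_s <-]] := trdeg_attained emb (lower_coefs p).
(* An independent family contains no zero, hence nothing from the gap, and [p_0 = p_1] leaves only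
   these [r] coefficients. *)
pose l := [seq p`_j | j <- iota 1 r].
have sub : {subset s <= l}.
  move=> x xs; have xn0 : x != 0.
    by apply: contraTneq xs => ->; exact: alg_indep_notin0 is_s.
  have := mem_subseq sl xs; rewrite /lower_coefs sp /= => /mapP [j].
  rewrite mem_iota add0n => /andP [_ jn] xE.
  have [j0|jn0] := posnP j.
    rewrite xE j0 (_ : p`_0 = p`_1); first by apply: map_f; rewrite mem_iota; lia.
    by rewrite !pE expr0 expr1 mulr1 -mulrA; congr (_ * _); rewrite divfK.
  rewrite xE; apply: map_f; rewrite mem_iota jn0 add1n.
  by rewrite ltnNge; apply: contra xn0 => rj; rewrite xE pE f_gap ?mulr0 // rj.
have us := alg_indep_uniq is_s.
by rewrite -[r](size_iota 1) -(size_map (fun j => p`_j)) uniq_leq_size.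
Qed.

End ScaledGenerator.

(** * The generic sparse polynomial and the lower bound *)

Section SparsePolynomial.
Variables (k : fieldType) (m n : nat).
Hypothesis m_gt0 : (0 < m)%N.
Hypothesis lt_mn : (m <= n - 1)%N.
Let r := (n - m)%N.
Let f := f_poly k m n.

Lemma f_polyE : f = 'X^n + \poly_(j < r.+1) gen_var k (inord (r - j)).
Proof.
rewrite /f /f_poly; congr (_ + _).
rewrite poly_def (reindex_inj rev_ord_inj) /=; apply: eq_bigr => i _.
by rewrite mul_polyC subSS -/r; congr (gen_var _ _ *: 'X^_);
  [apply: val_inj; rewrite /= inordK // ltnS leq_subr | rewrite subKn // -ltnS].
Qed.

Lemma r_gt0 : (0 < r)%N. Proof. by rewrite /r; lia. Qed.
Lemma lt_rn : (r < n)%N. Proof. by rewrite /r; lia. Qed.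

Lemma size_f_poly : size f = n.+1.
Proof.
rewrite f_polyE size_polyDl size_polyXn // ltnS.
exact: leq_trans (size_poly _ _) lt_rn.
Qed.

Lemma monic_f_poly : f \is monic.
Proof.
rewrite monicE lead_coefE size_f_poly f_polyE coefD coefXn eqxx coef_poly.
by rewrite ltnS leqNgt lt_rn addr0.
Qed.

Lemma coef_f_poly j : (j < n)%N ->
  f`_j = if (j < r.+1)%N then gen_var k (inord (r - j)) else 0.
Proof.
by move=> jn; rewrite f_polyE coefD coefXn (ltn_eqF jn) add0r coef_poly.
Qed.

Lemma gen_var_neq0 N (i : 'I_N) : gen_var k i != 0.
Proof.
rewrite tofrac_eq0; apply/eqP => /(congr1 (mcoeff U_(i))) /eqP.
by rewrite mcoeffXU eqxx mcoeff0 oner_eq0.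
Qed.

Lemma size_f_poly_gt1 : (1 < size f)%N.
Proof. by rewrite size_f_poly ltnS; apply: leq_ltn_trans lt_rn. Qed.

Lemma generator_geq_trdeg (z : {poly %/ f}) (p : {poly ratfun k r.+1}) :
  [pchar k] =i pred0 -> (n <= 2 * m)%N -> generates z -> is_minpoly z p ->
  (r <= trdeg (@const_ratfun k r.+1) (lower_coefs p))%N.
Proof.
move=> char0 nm gen [pmon zp _].
have le_rm : (r <= m)%N by rewrite /r; lia.
have nE : (m + r = n)%N by rewrite /r subnKC; lia.
have fm := monic_f_poly; have fs := size_f_poly_gt1.
have [K [emb [a [x [a_indep sign_a xroot xfix xmove]]]]] :=
  exists_reflected_roots char0 m_gt0 le_rm.
pose S := mps K r.+1; pose tf : {rmorphism S -> {fraction S}} := @FracField.tofrac S.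
(* Specialising the variables to the coefficients of the deformed polynomial is injective, hence
   extends to the fraction fields. *)
pose phi : {rmorphism {mpoly k[r.+1]} -> S} := mmap (mpsC K r.+1 \o emb) a.
have [iota iotaE] : exists iota : {rmorphism ratfun k r.+1 -> {fraction S}},
    forall u, iota (FracField.tofrac u) = tf (phi u).
  apply: (@exists_fraction_lift _ _ (tf \o phi : {rmorphism _ -> _})) => u /= /eqP.
  by rewrite tofrac_eq0 => /eqP /a_indep.
have [sg sgE] : exists sg : 'I_r.+1 -> {rmorphism {fraction S} -> {fraction S}},
    forall j u, sg j (tf u) = tf (mps_sign j u).
  apply: (@fin_all_exists _ _ (fun j (s : {rmorphism {fraction S} -> {fraction S}}) =>
    forall u, s (tf u) = tf (mps_sign j u))) => j.
  apply: (@exists_fraction_lift _ _ (tf \o @mps_sign K r.+1 j : {rmorphism _ -> _})).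
  move=> u /= /eqP; rewrite tofrac_eq0 => /eqP h.
  by apply: (@mps_sign_inj _ _ j); rewrite h rmorph0.
have sg_iota j : sg j \o iota =1 iota.
  apply: (eq_fraction_rmorphism (f := sg j \o iota)) => u /=.
  rewrite iotaE sgE; congr (tf _); rewrite /phi /= rmorph_mmap.
  by apply: eq_mmap => i /=; rewrite ?mps_signC ?sign_a.
have sgK j : sg j \o sg j =1 idfun.
  apply: (eq_fraction_rmorphism (f := sg j \o sg j) (g := idfun)) => u /=.
  by rewrite !sgE mps_signK.
have sgC i j : sg i \o sg j =1 sg j \o sg i.
  apply: (eq_fraction_rmorphism (f := sg i \o sg j) (g := sg j \o sg i)) => u /=.
  by rewrite !sgE mps_signCA.
have map_sg j q : map_poly (sg j) (map_poly iota q) = map_poly iota q.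
  by apply/polyP => l; rewrite !coef_map; exact: sg_iota.
have froot i : root (map_poly iota f) (tf (x i)).
  have -> : map_poly iota f =
      map_poly tf ('X^(m + r) + \sum_(l < r.+1) (a l)%:P * 'X^(r - l)).
    rewrite /f /f_poly !rmorphD /= !map_polyXn nE; congr (_ + _).
    rewrite !rmorph_sum; apply: eq_bigr => l _.
    rewrite !rmorphM /= !map_polyXn !map_polyC /= iotaE.
    by rewrite /phi /= mmapX mmap1U.
  by rewrite /root horner_map (eqP (xroot i)) rmorph0.
(* The conjugate of [z] attached to the root [x i]. *)
pose Z i := (map_poly iota (val z)).[tf (x i)].
have evalZ i q : (map_poly iota (val (horner_alg z q))).[tf (x i)] =
    (map_poly iota q).[Z i].
  rewrite -{1}(in_qpoly_val z) horner_alg_in_qpoly.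
  by rewrite (horner_in_qpoly fm fs _ (froot i)) map_comp_poly horner_comp.
have Zroot i : root (map_poly iota p) (Z i).
  by rewrite /root -evalZ zp rmorph0 horner0.
have sg_horner j q y : sg j (map_poly iota q).[y] = (map_poly iota q).[sg j y].
  by rewrite -horner_map map_sg.
pose w i : 'I_r.+1 := lift ord_max i.
have Zroot' i : root (map_poly iota p) (sg (w i) (Z i)).
  by rewrite /root -sg_horner (eqP (Zroot i)) rmorph0.
(* As [z] generates, [x i] is a polynomial in [Z i] with coefficients fixed by the reflections;
   fixing [Z i] would fix [x i]. *)
have Zmove i : Z i - sg (w i) (Z i) != 0.
  rewrite subr_eq0; apply: contra (xmove i) => /eqP e.
  have [q qE] := gen (in_qpoly f 'X).
  have xE : tf (x i) = (map_poly iota q).[Z i].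
    by rewrite -evalZ -qE (horner_in_qpoly fm fs _ (froot i)) map_polyX hornerX.
  have : tf (mps_sign (w i) (x i)) = tf (x i).
    by rewrite -sgE xE sg_horner -e.
  by move/eqP; rewrite tofrac_eq.
have Zfix i j : j != i -> sg (w j) (Z i) = Z i.
  by move=> ji; rewrite /Z sg_horner sgE xfix.
(* The own reflection is an involution, so it negates the difference; the others commute with it and
   fix [Z i]. *)
have Zsign i j : sg (w j) (Z i - sg (w i) (Z i)) =
    (-1) ^+ (i == j) * (Z i - sg (w i) (Z i)).
  rewrite rmorphB; case: eqP => [->|/eqP ij].
    by have := sgK (w j) (Z j); rewrite /= mulN1r opprB => ->.
  have ji : j != i by rewrite eq_sym.
  by have := sgC (w j) (w i) (Z i); rewrite /= mul1r => ->; rewrite (Zfix _ _ ji).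
(* The differences lie in the fraction field, so their parities are expressed through numerators and
   denominators. *)
have [u hu] := fin_all_exists (fun i => fracE (Z i - sg (w i) (Z i))).
have [v hv] := fin_all_exists hu.
have v0 i : v i != 0 by case: (hv i).
have ZE i : Z i - sg (w i) (Z i) = tf (u i) / tf (v i) by case: (hv i).
have u0 i : u i != 0.
  by apply: contra (Zmove i) => /eqP ui; rewrite ZE ui rmorph0 mul0r.
have uvE i j : mps_sign (w j) (u i) * v i =
    (-1) ^+ (i == j) * (u i * mps_sign (w j) (v i)).
  have := Zsign i j; rewrite ZE fmorph_div !sgE mulrA => /eqP.
  have sv0 : mps_sign (w j) (v i) != 0.
    by rewrite -(rmorph0 (mps_sign (w j))) (inj_eq (@mps_sign_inj _ _ _)).
  rewrite eqr_div ?tofrac_eq0 // -(rmorph1 tf) -rmorphN -rmorphXn -!rmorphM.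
  by rewrite tofrac_eq mulrA => /eqP.
have two0 : 2%:R != 0 :> K.
  have charK : [pchar K] =i pred0 by move=> l; rewrite (fmorph_pchar emb) char0.
  by move/pcharf0P: charK => ->.
have ind := reflected_indep two0 u0 v0 uvE.
apply: (leq_trdeg_lower_coefs
  (emb := @FracField.tofrac _ \o @mpolyC r.+1 k : {rmorphism k -> ratfun k r.+1})
  pmon Zroot Zroot') => q q0.
apply: ind; rewrite -[RHS]q0; apply: eq_mmap => [c|i]; last by rewrite ZE.
by rewrite /= iotaE /phi /= mmapC.
Qed.

End SparsePolynomial.

(* k of characteristic 0; F = k(a_m,...,a_n) = ratfun k (n-m+1);
   E = F[x]/(f(x)) = {poly %/ f_poly k m n}; conclusion: tau(E/F) = n - m. *)
Theorem theorem9p1 (k : fieldType) (m n : nat) :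
  [pchar k] =i pred0 ->
  (0 < m)%N -> (n <= 2 * m)%N -> (m <= n - 1)%N ->
  tau_is (@const_ratfun k (n - m).+1) {poly %/ f_poly k m n} (n - m).
Proof.
move=> char0 m0 nm mn.
split=> [|z p]; last exact: generator_geq_trdeg.
have r0 : (0 < n - m)%N by lia.
have rn : (n - m < n)%N by lia.
have [||| z [p [gz mz le]]] := generator_leq_trdeg
  (@FracField.tofrac _ \o @mpolyC (n - m).+1 k : {rmorphism k -> ratfun k (n - m).+1})
  (monic_f_poly k m0 mn) (size_f_poly k m0 mn) r0 rn.
- by rewrite coef_f_poly ?gen_var_neq0 // (leq_ltn_trans _ rn).
- by rewrite coef_f_poly ?ltnS ?r0 ?gen_var_neq0 // (leq_ltn_trans r0 rn).
- by move=> j /andP [rj jn]; rewrite coef_f_poly // ltnS leqNgt rj.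
exists z, p; split=> //.
by apply/anti_leq; rewrite le; apply: generator_geq_trdeg gz mz.
Qed.
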